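(* Let $X \subset \mathbb{R}^2$ be a self-entwined ray, and let $\overline{X}$ denote its closure in $\mathbb{R}^2$. Then $\overline{X}$ is non-Suslinian; that is, there is an uncountable collection of pairwise-disjoint, non-degenerate subcontinua of $\overline{X}$.
   Context: A ray is a continuous one-to-one image of $[0,\infty)$, i.e. a space $X$ (here with the subspace topology from $\mathbb{R}^2$) for which there is a continuous bijection $f:[0,\infty)\to X$ (whose inverse need not be continuous). An arc is a homeomorphic copy of $[0,1]$. A ray $X$ is self-entwined if no open set $U$ has the property that $U\cap X$ is non-empty and contained in an arc lying in $X$. A continuum is a compact connected metric space; it is non-degenerate if it has more than one point. A space is non-Suslinian if it contains an uncountable collection of pairwise-disjoint, non-degenerate subcontinua. *)

(* Defs.v *)
From mathcomp Require Import all_boot all_order all_algebra.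
From mathcomp Require Import all_classical all_reals all_analysis.

Set Implicit Arguments.
Unset Strict Implicit.
Unset Printing Implicit Defensive.

Import Order.TTheory GRing.Theory Num.Theory.
Import numFieldNormedType.Exports.

Local Open Scope classical_set_scope.
Local Open Scope ring_scope.

(* Spaces are subsets of an ambient topological space, with the subspace
   topology: [{within A, continuous f}] is continuity of the restriction of [f]
   to [A], so values of [f] and [g] off [A] and [B] are irrelevant below. *)
Definition homeomorphic (T U : topologicalType) (A : set T) (B : set U) : Prop :=
  exists (f : T -> U) (g : U -> T),
    [/\ set_bij A B f, {in A, cancel f g},
        {within A, continuous f} & {within B, continuous g}].

Definition is_arc (R : realType) (T : topologicalType) (A : set T) : Prop :=
  homeomorphic (`[0, 1] : set R) A.

Definition is_ray (R : realType) (T : topologicalType) (X : set T) : Prop :=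
  exists f : R -> T,
    {within `[0, +oo[, continuous f} /\ set_bij `[0, +oo[ X f.

Definition self_entwined (R : realType) (T : topologicalType) (X : set T) : Prop :=
  ~ exists U : set T,
      [/\ open U, U `&` X !=set0 &
          exists A : set T, [/\ is_arc R A, A `<=` X & U `&` X `<=` A]].

(* Metrizability is not recorded: it is automatic for subsets of the plane. *)
Definition continuum (T : topologicalType) (K : set T) : Prop :=
  compact K /\ connected K.

Definition non_degenerate (T : Type) (K : set T) : Prop :=
  exists x y : T, [/\ K x, K y & x <> y].

Definition non_suslinian (T : topologicalType) (A : set T) : Prop :=
  exists C : set (set T),
    [/\ ~ countable C,
        forall K, C K -> [/\ K `<=` A, continuum K & non_degenerate K] &
        forall K L, C K -> C L -> K <> L -> K `&` L = set0].

(* Main.v *)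
Require Import Defs.
From mathcomp Require Import all_boot all_order all_algebra.
From mathcomp Require Import all_classical all_reals all_analysis.
From mathcomp Require Import ring lra.
Import Order.TTheory GRing.Theory Num.Theory.
Import numFieldNormedType.Exports.
Set Implicit Arguments.
Unset Strict Implicit.
Unset Printing Implicit Defensive.

Local Open Scope classical_set_scope.
Local Open Scope ring_scope.

(** Parametrize the ray by a continuous [f] that is injective on [0, oo).  Each
    [f ([0, b])] is an arc, so self-entwinement says that [f] comes back at
    arbitrarily large times to every open set that meets the ray [X].

    Fix an open square [D] that [f] keeps leaving.  The ray crosses [D] in
    passes, the pieces [f ([u, v])] where ]u, v[ is a component of the set of
    times spent in [D].  Passes are disjoint in [D], and each of them cuts [D]
    into two sides.  There are two cases.

    Suppose first that, for some [D], the passes separate points of [X] in every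
    smaller square centered on [X].  A point [z] of [D] in the closure of [X] but
    not in [X] is a limit of ever later points of [X]; the portions of [f] that
    start at those points and end on a fixed small square around [z] accumulate
    on a continuum [K z] which never changes side of a pass
    ([side_continuum]).  If two passes separate [z] from [z'], one of them lying
    between [z] and the other, then [K z] and [K z'] are disjoint.  Since [X] is
    nowhere locally one-sided and is of first category in its closure, a
    diagonal argument with nested squares yields a [z] whose continuum avoids any
    given countable family of such continua; a maximal disjoint family is thus
    uncountable ([non_suslinian_mixed]).

    Otherwise every [D] contains a square [U], centered on [X], such that no pass
    of [D] separates two points of [X] in [U].  Take three disjoint squares [D_j]
    with such [U_j], three disjoint stretches [V_i] of the ray, each of them
    meeting all three [U_j], and a further point [p_j] of [X] in each [U_j].
    Joining [p_j] by a segment to a point of [V_i] in [U_j], and then following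
    [V_i] to its origin [b_i], draws the graph K_{3,3} on the vertices [p_j] and
    [b_i].  The segments may meet the [V_i], but since passes do not separate the
    ends of these segments they do so an even number of times: independent edges
    cross evenly.  This is impossible in the plane, by the parity argument of
    van Kampen ([k33_not_planar]).

    All the plane topology is carried by one invariant, the crossing parity of
    two paths ([crossing]).  It is the winding number modulo 2 of the difference
    [g1 s - g2 t] along the boundary of a rectangle, and it vanishes for disjoint
    paths because a rectangle is simply connected ([ex_labelling_rect]).  The two
    sides of a pass are also defined by this parity, so that neither the Jordan
    curve theorem nor connected components of complements are involved. *)

(** * The branch cut of the argument, modulo two turns *)

Section Parity.
Context {R : realType}.
Implicit Types u v w : (R * R)%type.

Definition dot u v : R := u.1 * v.1 + u.2 * v.2.
Definition det u v : R := u.1 * v.2 - u.2 * v.1.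
(** The vectors of argument in ]0, pi].  The bounds are half-open so that
    exactly one of [u] and [- u] qualifies when [u] is nonzero. *)
Definition upper u : bool := (0 < u.2) || ((u.2 == 0) && (u.1 < 0)).
(** For [u] and [v] in a common open half-plane, this tells whether the short turn from
    [u] to [v] passes through the negative real axis, where the principal argument
    jumps by one turn. *)
Definition flip u v : bool :=
  (upper u != upper v) && (if upper u then 0 < det u v else det u v < 0).

Lemma flipuu u : flip u u = false.
Proof. by rewrite /flip eqxx. Qed.

Lemma upperN u : u != 0 -> upper (- u) = ~~ upper u.
Proof.
case: u => x y; rewrite /upper /= oppr_gt0 oppr_lt0 oppr_eq0 -pair_eqE /pair_eq /=.
rewrite negb_and; case: (ltrgtP y 0) => //= _.
by rewrite orbF; case: (ltrgtP x 0).
Qed.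

Lemma dot_neq0 w u : 0 < dot w u -> u != 0.
Proof.
by apply: contraTneq => ->; rewrite /dot /= !mulr0 addr0 ltxx.
Qed.

Lemma flip_same u v : upper u = upper v -> flip u v = false.
Proof. by rewrite /flip => ->; rewrite eqxx. Qed.

Lemma flipC u v : flip u v = flip v u.
Proof.
rewrite /flip eq_sym; case: eqVneq => //= uv.
have -> : det v u = - det u v by rewrite /det; ring.
rewrite oppr_gt0 oppr_lt0.
by move: uv; case: (upper u); case: (upper v).
Qed.

Lemma flip_up u v : upper u -> ~~ upper v -> flip u v = (0 < det u v).
Proof. by move=> hu /negbTE hv; rewrite /flip hu hv. Qed.

Lemma upperP u : upper u -> 0 <= u.2 /\ (u.2 = 0 -> u.1 < 0).
Proof.
by case/orP => [h|/andP[/eqP h k]]; split => //; [exact: ltW|move=> e; rewrite e ltxx in h|rewrite h].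
Qed.

Lemma upperPn u : ~~ upper u -> u.2 <= 0 /\ (u.2 = 0 -> 0 <= u.1).
Proof.
rewrite negb_or negb_and -!leNgt => /andP[h k]; split => // e.
by move: k; rewrite e eqxx.
Qed.


(** The three vectors satisfy [det u v * x + det v x * u + det x u * v = 0].  In an open
    half-plane such a relation needs coefficients of both signs, and its second
    coordinate then forces [x] and [v] onto the real axis. *)
Lemma det_sign_upper w u v x : 0 < dot w u -> 0 < dot w v -> 0 < dot w x ->
  upper u -> upper v -> ~~ upper x -> 0 < det u x -> 0 < det v x.
Proof.
case: w u v x => [w1 w2] [u1 u2] [v1 v2] [x1 x2].
move=> hu hv hx /upperP[+ +] /upperP[+ +] /upperPn[+ +].
rewrite /det /dot /= in hu hv hx * => a1 a2 b1 b2 c1 c2 d1.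
rewrite ltNge; apply/negP => d2.
have uv : 0 < u1 * v2 - u2 * v1.
  suff : 0 < (u1 * v2 - u2 * v1) * (w1 * x1 + w2 * x2) by rewrite pmulr_lgt0.
  have -> : (u1 * v2 - u2 * v1) * (w1 * x1 + w2 * x2) =
    - (v1 * x2 - v2 * x1) * (w1 * u1 + w2 * u2)
    + (u1 * x2 - u2 * x1) * (w1 * v1 + w2 * v2) by ring.
  apply: ltr_wpDl; last exact: mulr_gt0.
  by apply: mulr_ge0; [rewrite oppr_ge0|exact: ltW].
have e : (u1 * v2 - u2 * v1) * x2 + (v1 * x2 - v2 * x1) * u2
   - (u1 * x2 - u2 * x1) * v2 = 0 by ring.
have h1 : (u1 * v2 - u2 * v1) * x2 <= 0 by rewrite pmulr_rle0.
have h2 : (v1 * x2 - v2 * x1) * u2 <= 0 by rewrite mulr_le0_ge0.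
have h3 : 0 <= (u1 * x2 - u2 * x1) * v2 by rewrite mulr_ge0 // ltW.
have x20 : x2 = 0.
  have /eqP : (u1 * v2 - u2 * v1) * x2 = 0 by lra.
  by rewrite mulf_eq0 gt_eqF //= => /eqP.
have v20 : v2 = 0.
  have /eqP : (u1 * x2 - u2 * x1) * v2 = 0 by lra.
  by rewrite mulf_eq0 gt_eqF //= => /eqP.
subst x2 v2; have {}b2 := b2 erefl; have {}c2 := c2 erefl.
clear -b2 c2 hv hx; nra.
Qed.

Lemma det_upper_neq0 w y z : 0 < dot w y -> 0 < dot w z ->
  upper y -> ~~ upper z -> det y z != 0.
Proof.
case: w y z => [w1 w2] [y1 y2] [z1 z2] wy wz /upperP[a1 a2] /upperPn[b1 b2].
rewrite /dot /det /= in wy wz a1 a2 b1 b2 *; apply/eqP => e.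
have e2 : (w1 * y1 + w2 * y2) * z2 = (w1 * z1 + w2 * z2) * y2.
  apply/eqP; rewrite -subr_eq0; apply/eqP.
  by transitivity (w1 * (y1 * z2 - y2 * z1)); [ring|rewrite e mulr0].
have e1 : (w1 * y1 + w2 * y2) * z1 = (w1 * z1 + w2 * z2) * y1.
  apply/eqP; rewrite -subr_eq0; apply/eqP.
  by transitivity (- w2 * (y1 * z2 - y2 * z1)); [ring|rewrite e mulr0].
have h1 : (w1 * y1 + w2 * y2) * z2 <= 0 by rewrite pmulr_rle0.
have h2 : 0 <= (w1 * z1 + w2 * z2) * y2 by rewrite pmulr_rge0.
have /eqP : (w1 * z1 + w2 * z2) * y2 = 0 by lra.
rewrite mulf_eq0 gt_eqF //= => /eqP /a2 y1n.
have /eqP : (w1 * y1 + w2 * y2) * z2 = 0 by lra.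
rewrite mulf_eq0 gt_eqF //= => /eqP /b2 z1p.
have h3 : (w1 * z1 + w2 * z2) * y1 < 0 by rewrite pmulr_rlt0.
have h4 : 0 <= (w1 * y1 + w2 * y2) * z1 by rewrite pmulr_rge0.
lra.
Qed.

(** Whether the cut is crossed on the way to [x] depends only on the side of the real axis
    that one starts from: within a half-plane, [u] and [v] are then joined without meeting
    the cut. *)
Lemma flip_upE w u v x : 0 < dot w u -> 0 < dot w v -> 0 < dot w x ->
  upper u = upper v -> flip u x = flip v x.
Proof.
move=> hu hv hx; case hU : (upper u); case hV : (upper v) => // _; last first.
  have dN y z : 0 < dot y z -> 0 < dot (- y) (- z) by rewrite /dot /= !mulrNN.
  have detN y z : det y z = det (- y) (- z) by rewrite /det /= !mulrNN.
  case hX : (upper x); last by rewrite !flip_same ?hU ?hV ?hX.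
  rewrite flipC flip_up ?hU // flipC flip_up ?hV //.
  have detC y z : det y z = - det z y by rewrite /det; ring.
  have uN y z : 0 < dot z y -> upper y = false -> upper (- y) = true.
    by move=> h e; rewrite upperN ?e // (dot_neq0 h).
  have uNx : upper (- x) = false by rewrite upperN ?hX // (dot_neq0 hx).
  have nz y : 0 < dot w y -> upper y = false -> det y x != 0.
    move=> wy uy; have := det_upper_neq0 hx wy hX (negbT uy).
    by apply: contraNneq; rewrite /det => e; apply/eqP; lra.
  rewrite [det x u]detC [det x v]detC !oppr_gt0 !ltNge !le_eqVlt.
  rewrite ![0 == _]eq_sym !(negbTE (nz _ _ _)) //=; congr (~~ _).
  have H y z : 0 < dot w y -> 0 < dot w z -> upper y = false -> upper z = false ->
      0 < det y x -> 0 < det z x.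
    move=> wy wz uy uz; rewrite detN [det z x]detN.
    apply: (@det_sign_upper (- w)); [exact: dN|exact: dN|exact: dN| | |by rewrite uNx].
      exact: uN wy uy.
    exact: uN wz uz.
  by apply/idP/idP; exact: H.
case hX : (upper x); first by rewrite !flip_same ?hU ?hV ?hX.
rewrite !flip_up ?hX //.
by apply/idP/idP; apply: (@det_sign_upper w); rewrite ?hX.
Qed.

(** Inside an open half-plane the argument can be chosen continuously, and [flip] is the
    coboundary of the parity of its discrepancy with the principal argument. *)
Lemma flip_cocycle w u v x : 0 < dot w u -> 0 < dot w v -> 0 < dot w x ->
  flip u x = flip u v (+) flip v x.
Proof.
move=> hu hv hx.
have [e|ne] := eqVneq (upper u) (upper v).
  by rewrite (flip_same e) (flip_upE hu hv hx e).
have [e|ne2] := eqVneq (upper v) (upper x).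
  by rewrite (flip_same e) addbF flipC [RHS]flipC (flip_upE hx hv hu).
have e : upper u = upper x.
  by move: ne ne2; case: (upper u); case: (upper v); case: (upper x).
by rewrite (flip_same e) (flip_upE hu hx hv e) flipC addbb.
Qed.

(** Going from [- u] to [- v] meets the cut when going from [u] to [v] meets the positive
    real axis, and the two half-axes together are met iff the half-plane changes. *)
Lemma flipNN w u v : 0 < dot w u -> 0 < dot w v ->
  flip (- u) (- v) = flip u v (+) upper u (+) upper v.
Proof.
move=> hu hv.
have [e|ne] := eqVneq (upper u) (upper v).
  rewrite !flip_same ?upperN ?(dot_neq0 hu) ?(dot_neq0 hv) ?e //.
  by rewrite -addbA addbb.
have detN y z : det (- y) (- z) = det y z by rewrite /det /= !mulrNN.
suff H y z : 0 < dot w y -> 0 < dot w z -> upper y -> ~~ upper z ->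
    flip (- y) (- z) = ~~ flip y z.
  move: ne; case hU : (upper u); case hV : (upper v) => // _.
    by rewrite H ?hU ?hV // addbF addbT.
  by rewrite flipC H ?hU ?hV // flipC addbF addbT.
move=> wy wz uy uz; rewrite [LHS]flipC !flip_up ?upperN ?(dot_neq0 wy) ?(dot_neq0 wz) ?uy //.
rewrite detN -leNgt.
have -> : det z y = - det y z by rewrite /det; ring.
rewrite oppr_gt0 lt_neqAle.
by rewrite (det_upper_neq0 wy wz uy uz).
Qed.

End Parity.

(** * Continuous choice of a square root *)

Section Cousin.
Context {R : realType}.

(** Additive properties pass from small intervals to all intervals: extend from [a] as far
    as possible and look at the supremum. *)
Lemma cousin (a b : R) (P : R -> R -> Prop) : a <= b ->
  (forall x, a <= x <= b -> exists2 d : R, 0 < d &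
     forall u v, a <= u -> u <= x -> x <= v -> v <= b -> v - u < d -> P u v) ->
  (forall u v w, a <= u -> u <= v -> v <= w -> w <= b -> P u v -> P v w -> P u w) ->
  P a b.
Proof.
move=> ab loc glue.
pose S := [set x | a <= x <= b /\ P a x].
have Sa : S a.
  split; first by rewrite lexx.
  have [|d d0 h] := loc a; first by rewrite lexx.
  by apply: h => //; rewrite subrr.
have ubS : ubound S b by move=> x [/andP[]].
have hs : has_sup S by split; [exists a|exists b].
have acb : a <= sup S <= b.
  by apply/andP; split; [exact: sup_upper_bound|apply: ge_sup => //; exists a].
have [d d0 h] := loc _ acb.
have [x Sx xd] := sup_adherent d0 hs.
have [/andP[ax xb] Px] := Sx.
have xc : x <= sup S by apply: sup_upper_bound.
case/andP: acb => ac cb.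
(* Beyond [sup S], and less than [d] to the right of [x]. *)
pose y := Num.min b (sup S + (d - (sup S - x)) / 2).
have cy : sup S <= y by rewrite le_min cb /=; lra.
have yd : y <= sup S + (d - (sup S - x)) / 2 by rewrite ge_min lexx orbT.
have yb : y <= b by rewrite ge_min lexx.
have Py : P a y.
  apply: (glue a x y) => //; first exact: le_trans xc cy.
  by apply: h => //; lra.
have : y <= sup S.
  by apply: sup_upper_bound => //; split => //; rewrite yb (le_trans ac cy).
rewrite /y ge_min => /orP[bc|]; last lra.
by have <- : y = b by apply/eqP; rewrite eq_le yb (le_trans bc cy).
Qed.

Lemma near_itv (x : R) (P : R -> Prop) : (\forall t \near x, P t) ->
  exists2 d : R, 0 < d & forall t, `|x - t| < d -> P t.
Proof. by move=> /nbhs_ballP[d /= d0 h]; exists d => // t xt; apply: h. Qed.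

Lemma locally_constant_itv (a b : R) (phi : R -> bool) : a <= b ->
  (forall t, a <= t <= b -> \forall s \near t, a <= s <= b -> phi s = phi t) ->
  forall t, a <= t <= b -> phi t = phi a.
Proof.
move=> ab h t /andP[aT tb]; apply/esym.
apply: (@cousin a t (fun u v => phi u = phi v)) => // [x /andP[ax xt]|u v w _ _ _ _ -> //].
have /near_itv[d d0 hd] : \forall s \near x, a <= s <= b -> phi s = phi x.
  by apply: h; rewrite ax (le_trans xt tb).
exists d => // u v au ux xv vt uv.
transitivity (phi x); [|apply/esym]; apply: hd.
- by rewrite ger0_norm ?subr_ge0 //; lra.
- by rewrite au (le_trans ux) // (le_trans xt).
- by rewrite ler0_norm ?subr_le0 //; lra.
- by rewrite (le_trans au) ?(le_trans ux) //= (le_trans vt).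
Qed.

End Cousin.

Section Labelling.
Context {R : realType}.

(** A labelling is a continuous square root of [F], where the plane is the complex line:
    [s t] selects the root of [F t] that is continuous in [t] by its sign relative to
    the principal root. *)
Definition labelling (T : topologicalType) (A : set T) (F : T -> R * R) (s : T -> bool) :=
  forall t0, A t0 -> \forall t \near t0, A t -> s t = s t0 (+) flip (F t0) (F t).

(** Where [F] stays in an open half-plane, a fixed vector of that half-plane serves as
    reference. *)
Lemma labelling_half (T : topologicalType) (A : set T) (F : T -> R * R) w u :
  0 < dot w u -> (forall t, A t -> 0 < dot w (F t)) -> labelling A F (fun t => flip u (F t)).
Proof.
move=> wu h t0 At0; apply: nearW => t At.
by rewrite (@flip_cocycle _ w u (F t0)) // ; exact: h.
Qed.

Lemma labelling_sub (T : topologicalType) (A B : set T) (F : T -> R * R) s :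
  B `<=` A -> labelling A F s -> labelling B F s.
Proof.
move=> BA h t0 Bt0; have := h _ (BA _ Bt0).
by apply: filterS => t ht Bt; apply: ht; exact: BA.
Qed.

Lemma labelling_comp (T U : topologicalType) (A : set T) (B : set U)
    (phi : U -> T) (F : T -> R * R) s :
  continuous phi -> (forall x, B x -> A (phi x)) ->
  labelling A F s -> labelling B (F \o phi) (s \o phi).
Proof.
move=> cphi BA h t0 Bt0.
have : \forall t \near t0, A (phi t) ->
    s (phi t) = s (phi t0) (+) flip (F (phi t0)) (F (phi t)).
  exact: cphi t0 _ (h _ (BA _ Bt0)).
by apply: filterS => t /= ht Bt; apply: ht; exact: BA.
Qed.

Lemma labelling_diff (T : topologicalType) (A : set T) (F : T -> R * R) s1 s2 :
  labelling A F s1 -> labelling A F s2 -> forall t0, A t0 ->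
  \forall t \near t0, A t -> s1 t (+) s2 t = s1 t0 (+) s2 t0.
Proof.
move=> h1 h2 t0 At0; near=> t; move=> At.
have -> : s1 t = s1 t0 (+) flip (F t0) (F t) by move: At; near: t; exact: h1.
have -> : s2 t = s2 t0 (+) flip (F t0) (F t) by move: At; near: t; exact: h2.
by rewrite addbACA addbb addbF.
Unshelve. all: by end_near. Qed.

(** At a common point the two labellings are both compared with their value there, so
    that agreement up to a constant on the intersection is enough. *)
Lemma labelling_glue (T : topologicalType) (A B : set T) (F : T -> R * R) s1 s2 k :
  closed A -> closed B -> labelling A F s1 -> labelling B F s2 ->
  (forall t, A t -> B t -> s1 t = s2 t (+) k) ->
  exists s, labelling (A `|` B) F s.
Proof.
move=> cA cB h1 h2 h.
exists (fun t => if `[< A t >] then s1 t else s2 t (+) k).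
set s := fun t => _.
have sA t : A t -> s t = s1 t by rewrite /s; case: asboolP.
have sB t : B t -> s t = s2 t (+) k.
  by move=> Bt; rewrite /s; case: asboolP => // At; exact: h.
have nA t0 : A t0 -> \forall t \near t0, A t -> s t = s t0 (+) flip (F t0) (F t).
  move=> At0; near=> t; move=> At; rewrite !sA //; move: At.
  by near: t; exact: h1.
have nB t0 : B t0 -> \forall t \near t0, B t -> s t = s t0 (+) flip (F t0) (F t).
  move=> Bt0; near=> t; move=> Bt; rewrite !sB // addbAC; congr (_ (+) _); move: Bt.
  by near: t; exact: h2.
have out (C : set T) (cC : closed C) t0 : ~ C t0 -> \forall t \near t0, ~ C t.
  by move=> Ct0; apply: open_nbhs_nbhs; split => //; exact: closed_openC.
move=> t0 ABt0.
have HA : \forall t \near t0, A t -> s t = s t0 (+) flip (F t0) (F t).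
  have [|nAt0] := pselect (A t0); first exact: nA.
  by near=> t => At; exfalso; move: At; near: t; exact: out.
have HB : \forall t \near t0, B t -> s t = s t0 (+) flip (F t0) (F t).
  have [|nBt0] := pselect (B t0); first exact: nB.
  by near=> t => Bt; exfalso; move: Bt; near: t; exact: out.
near=> t; move=> [|]; near: t.
- exact: HA.
- exact: HB.
Unshelve. all: by end_near. Qed.

Lemma dot_gt0 (u : R * R) : u != 0 -> 0 < dot u u.
Proof.
case: u => x y nz; rewrite lt_neqAle /dot /= -!expr2 addr_ge0 ?sqr_ge0 // andbT eq_sym.
by rewrite paddr_eq0 ?sqr_ge0 // !sqrf_eq0; move: nz; rewrite -pair_eqE.
Qed.

Lemma near_dot (T : topologicalType) (F : T -> R * R) t0 :
  {for t0, continuous F} -> F t0 != 0 -> \forall t \near t0, 0 < dot (F t0) (F t).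
Proof.
move=> cF nz.
have : (fun t => dot (F t0) (F t)) @ t0 --> dot (F t0) (F t0).
  apply: cvgD; apply: cvgMl_tmp.
    by apply: (@cvg_comp _ _ _ F fst _ (nbhs (F t0))) => //; exact: cvg_fst.
  by apply: (@cvg_comp _ _ _ F snd _ (nbhs (F t0))) => //; exact: cvg_snd.
move/cvgr_gt; apply; exact: dot_gt0.
Qed.

Lemma continuous_pair (T U V : topologicalType) (f : T -> U) (g : T -> V) :
  continuous f -> continuous g -> continuous (fun t => (f t, g t)).
Proof. by move=> cf cg x; exact: (cvg_pair (cf x) (cg x)). Qed.

Definition rect (a b c d : R) : set (R * R) :=
  [set p | a <= p.1 <= b /\ c <= p.2 <= d].

Lemma closed_rect a b c d : closed (rect a b c d).
Proof.
have -> : rect a b c d = (fst @^-1` `[a, b]) `&` (snd @^-1` `[c, d]).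
  by apply/seteqP; split => p /=; rewrite !in_itv /=.
by apply: closedI; apply: closed_comp => [x _|]; [exact: cvg_fst|exact: itv_closed|exact: cvg_snd|exact: itv_closed].
Qed.

(** A rectangle carries no monodromy: labellings of small rectangles are glued along
    segments, on which they differ by a constant, first into thin vertical strips and
    then across the strips. *)
Lemma ex_labelling_rect (a b c d : R) (F : R * R -> R * R) : a <= b -> c <= d ->
  continuous F -> (forall p, rect a b c d p -> F p != 0) ->
  exists s, labelling (rect a b c d) F s.
Proof.
move=> ab cd cF nz.
have glue (A B : set (R * R)) (phi : R -> R * R) s1 s2 x y :
    closed A -> closed B -> continuous phi -> x <= y ->
    (forall t, x <= t <= y -> A (phi t) /\ B (phi t)) ->
    (forall p, A p -> B p -> exists2 t, x <= t <= y & p = phi t) ->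
    labelling A F s1 -> labelling B F s2 -> exists s, labelling (A `|` B) F s.
  move=> cA cB cphi xy hAB h l1 l2.
  apply: (@labelling_glue _ A B F s1 s2 (s1 (phi x) (+) s2 (phi x))) => // p Ap Bp.
  have [t txy ->] := h _ Ap Bp.
  have := @locally_constant_itv _ x y (fun t => s1 (phi t) (+) s2 (phi t)) xy.
  move=> /(_ _ t txy) <-; first by rewrite addbCA addbb addbF.
  apply: (@labelling_diff _ [set t | x <= t <= y] (F \o phi) (s1 \o phi) (s2 \o phi)).
    by apply: (@labelling_comp _ _ A) => // z zxy; case: (hAB _ zxy).
  by apply: (@labelling_comp _ _ B) => // z zxy; case: (hAB _ zxy).
apply: (@cousin _ a b (fun u v => exists s, labelling (rect u v c d) F s)) => //; last first.
  move=> u v w au uv vw wb [s1 h1] [s2 h2].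
  have -> : rect u w c d = rect u v c d `|` rect v w c d.
    apply/seteqP; split => [[x y] [/= /andP[ux xw] cyd]|[x y]].
      have [xv|/ltW vx] := leP x v; [left|right]; split => //=.
        by rewrite ux.
      by rewrite vx.
    move=> [] [/= /andP[p q] r]; split => //=; first by rewrite p (le_trans q).
    by rewrite q (le_trans uv).
  apply: (@glue _ _ (fun t => (v, t)) s1 s2 c d) => //; try exact: closed_rect.
  - by apply: continuous_pair => t; [exact: cvg_cst|exact: cvg_id].
  - by move=> t ctd; split; split => //=; rewrite ?uv ?vw lexx.
  - move=> [x y] [/= /andP[_ xv] cyd] [/= /andP[vx _] _]; exists y => //.
    by congr pair; apply/eqP; rewrite eq_le xv vx.
move=> s0 s0ab.
pose Q t1 t2 := exists2 e, 0 < e & forall u v, u <= s0 -> s0 <= v -> v - u < e ->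
   exists s, labelling (rect u v t1 t2) F s.
have : Q c d.
  apply: cousin => //.
    move=> t0 t0cd.
    have := near_dot (cF (s0, t0)) (nz (s0, t0) (conj s0ab t0cd)).
    move=> /nbhs_ballP[e /= e0 he].
    exists e => // t1 t2 ct1 t10 t02 t2d t12; exists e => // u v us sv uv.
    exists (fun p => flip (F (s0, t0)) (F p)).
    apply: labelling_half; first exact: dot_gt0 (nz (s0, t0) (conj s0ab t0cd)).
    move=> [x y] [/= /andP[ux xv] /andP[t1y yt2]]; apply: he; split; rewrite /ball /=.
      by rewrite ltr_norml; apply/andP; split; lra.
    by rewrite ltr_norml; apply/andP; split; lra.
  move=> t1 t2 t3 ct1 t12 t23 t3d [e1 e10 h1] [e2 e20 h2].
  exists (Num.min e1 e2); first by rewrite lt_min e10.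
  move=> u v us sv; rewrite lt_min => /andP[uv1 uv2].
  have [s1 {}h1] := h1 u v us sv uv1; have [s2 {}h2] := h2 u v us sv uv2.
  have -> : rect u v t1 t3 = rect u v t1 t2 `|` rect u v t2 t3.
    apply/seteqP; split => [[x y] [/= uxv /andP[p q]]|[x y]].
      have [xv|/ltW vx] := leP y t2; [left|right]; split => //=.
        by rewrite p.
      by rewrite vx.
    move=> [] [/= r /andP[p q]]; split => //=; first by rewrite p (le_trans q).
    by rewrite q (le_trans t12).
  apply: (@glue _ _ (fun t => (t, t2)) s1 s2 u v) => //; try exact: closed_rect.
  - by apply: continuous_pair => t; [exact: cvg_id|exact: cvg_cst].
  - exact: le_trans us sv.
  - by move=> t ctd; split; split => //=; rewrite ?t12 ?t23 lexx.
  - move=> [x y] [/= uxv /andP[_ yt2]] [/= _ /andP[t2y _]]; exists x => //.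
    by congr pair; apply/eqP; rewrite eq_le yt2 t2y.
move=> [e e0 he]; exists e => // u v _ us sv _ uv; exact: he.
Qed.

End Labelling.

(** * Turning number and crossing parity of paths, modulo 2 *)

Section Turn.
Context {R : realType}.
Implicit Types (g : R -> R * R) (a b c d : R).

(** The parity of [n] when the argument of [g] varies, from [a] to [b], by the difference
    of the principal arguments at the ends plus [n] turns. *)
Definition turn g a b : bool :=
  `[< exists s, labelling [set t | a <= t <= b] g s /\ s a (+) s b >].

Lemma ex_labelling_itv g a b : a <= b -> continuous g ->
  (forall t, a <= t <= b -> g t != 0) ->
  exists s, labelling [set t | a <= t <= b] g s.
Proof.
move=> ab cg nz.
have [||p [pab _]|s hs] := @ex_labelling_rect R a b 0 0 (g \o fst) ab.
- by [].
- by move=> p; apply: continuous_comp; [exact: cvg_fst|exact: cg].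
- exact: nz.
exists (s \o (fun t => (t, 0))).
apply: (@labelling_comp _ _ _ _ _ (fun t => (t, 0)) (g \o fst) s _ _ hs).
- by apply: continuous_pair => t; [exact: cvg_id|exact: cvg_cst].
- by move=> t tab; split => //=; rewrite lexx.
Qed.

(** Two labellings differ by a constant, which cancels. *)
Lemma turnE g a b s : a <= b -> labelling [set t | a <= t <= b] g s ->
  turn g a b = s a (+) s b.
Proof.
move=> ab hs; apply/asboolP/idP => [[s' [hs' e]]|]; last by exists s.
have := @locally_constant_itv R a b (fun t => s t (+) s' t) ab (labelling_diff hs hs').
move=> /(_ b); rewrite ab lexx => /(_ isT).
by move: e; case: (s a); case: (s b); case: (s' a); case: (s' b).
Qed.

Lemma turn_add g a b c : continuous g -> a <= b -> b <= c ->
  (forall t, a <= t <= c -> g t != 0) ->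
  turn g a c = turn g a b (+) turn g b c.
Proof.
move=> cg ab bc nz; have ac := le_trans ab bc.
have [s hs] := ex_labelling_itv ac cg nz.
rewrite (turnE ac hs) (turnE ab (s := s)) ?(turnE bc (s := s)).
- by rewrite addbA addbK.
- by apply: labelling_sub hs => t /= /andP[bt ->]; rewrite (le_trans ab).
- by apply: labelling_sub hs => t /= /andP[-> tb]; rewrite (le_trans tb).
Qed.

Lemma turn_half w g a b : a <= b -> (forall t, a <= t <= b -> 0 < dot w (g t)) ->
  turn g a b = flip (g a) (g b).
Proof.
move=> ab h.
have ga : 0 < dot w (g a) by rewrite h // lexx.
rewrite (turnE ab (labelling_half (A := [set t | a <= t <= b]) ga h)).
by rewrite flipuu.
Qed.

Lemma turn_opp g a b : continuous g -> a <= b -> (forall t, a <= t <= b -> g t != 0) ->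
  turn (fun t => - g t) a b = turn g a b (+) upper (g a) (+) upper (g b).
Proof.
move=> cg ab nz; have [s hs] := ex_labelling_itv ab cg nz.
rewrite (turnE ab hs) (turnE ab (s := fun t => s t (+) upper (g t))).
  by rewrite -!addbA; congr (_ (+) _); rewrite addbCA.
move=> t0 t0ab; have nz0 := nz _ t0ab.
have ndot := near_dot (cg t0) nz0.
near=> t; move=> tab.
have d0 : 0 < dot (g t0) (g t0) by rewrite dot_gt0.
have dt : 0 < dot (g t0) (g t) by near: t.
rewrite (flipNN d0 dt).
have -> : s t = s t0 (+) flip (g t0) (g t) by move: tab; near: t; exact: hs.
by case: (s t0); case: (flip _ _); case: (upper (g t0)); case: (upper (g t)).
Unshelve. all: by end_near. Qed.

(** The winding number modulo 2 of [g1 s - g2 t] along the boundary of the rectangle,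
    hence the intersection number modulo 2 of the two paths.  It makes sense as soon
    as no end of either path lies on the other one.  The terms in [upper] appear
    because two sides of the rectangle are run through with the opposite vector
    [g2 t - g1 s]. *)
Definition crossing (g1 : R -> R * R) a b (g2 : R -> R * R) c d : bool :=
  turn (fun t => g1 t - g2 c) a b (+) turn (fun t => g1 t - g2 d) a b
  (+) turn (fun t => g2 t - g1 a) c d (+) turn (fun t => g2 t - g1 b) c d
  (+) upper (g2 c - g1 a) (+) upper (g2 d - g1 a)
  (+) upper (g2 c - g1 b) (+) upper (g2 d - g1 b).

(** When the paths are disjoint, a labelling of [g1 s - g2 t] on the whole rectangle
    evaluates the four sides, and each corner is counted twice. *)
Lemma crossing_disjoint g1 a b g2 c d : continuous g1 -> continuous g2 ->
  a <= b -> c <= d ->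
  (forall s t, a <= s <= b -> c <= t <= d -> g1 s <> g2 t) ->
  crossing g1 a b g2 c d = false.
Proof.
move=> c1 c2 ab cd dis.
pose F p := g1 p.1 - g2 p.2.
have cF : continuous F.
  have h1 : continuous (fun p : R * R => g1 p.1).
    by move=> p; apply: (@continuous_comp _ _ _ fst g1); [exact: cvg_fst|exact: c1].
  have h2 : continuous (fun p : R * R => g2 p.2).
    by move=> p; apply: (@continuous_comp _ _ _ snd g2); [exact: cvg_snd|exact: c2].
  by move=> p; exact: cvgB (h1 p) (h2 p).
have [s hs] : exists s, labelling (rect a b c d) F s.
  apply: ex_labelling_rect => // p [p1 p2].
  by rewrite subr_eq0; apply/eqP; exact: dis.
have row t : c <= t <= d -> turn (fun x => g1 x - g2 t) a b = s (a, t) (+) s (b, t).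
  move=> tcd; rewrite (turnE ab (s := fun x => s (x, t))) //.
  apply: (@labelling_comp _ _ _ _ _ (fun x => (x, t)) F s _ _ hs).
  - by apply: continuous_pair => x; [exact: cvg_id|exact: cvg_cst].
  - by [].
have col x : a <= x <= b -> turn (fun t => g2 t - g1 x) c d =
    s (x, c) (+) s (x, d) (+) upper (g2 c - g1 x) (+) upper (g2 d - g1 x).
  move=> xab.
  have nz t : c <= t <= d -> g1 x - g2 t != 0.
    by move=> tcd; rewrite subr_eq0; apply/eqP; exact: dis.
  have -> : (fun t => g2 t - g1 x) = (fun t => - (g1 x - g2 t)).
    by apply/funext => t; rewrite opprB.
  rewrite (@turn_opp (fun t => g1 x - g2 t)) //; last first.
    by move=> t; apply: cvgB; [exact: cvg_cst|exact: c2].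
  rewrite -!(opprB (g1 x)) !upperN ?nz ?lexx ?cd //.
  rewrite (turnE cd (s := fun t => s (x, t))).
    by rewrite !addbN addNb negbK.
  apply: (@labelling_comp _ _ _ _ _ (fun t => (x, t)) F s _ _ hs).
  - by apply: continuous_pair => t; [exact: cvg_cst|exact: cvg_id].
  - by [].
rewrite /crossing !row ?col ?lexx ?ab ?cd //.
have B p q r t u1 u2 u3 u4 : p (+) r (+) (q (+) t) (+) (p (+) q (+) u1 (+) u2) (+)
  (r (+) t (+) u3 (+) u4) (+) u1 (+) u2 (+) u3 (+) u4 = false.
  by move: p q r t u1 u2 u3 u4; do 8! case.
exact: B.
Qed.

Lemma crossing_sym g1 a b g2 c d : g1 a <> g2 c -> g1 a <> g2 d ->
  g1 b <> g2 c -> g1 b <> g2 d ->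
  crossing g1 a b g2 c d = crossing g2 c d g1 a b.
Proof.
move=> /eqP; rewrite -subr_eq0 => h1 /eqP; rewrite -subr_eq0 => h2.
move=> /eqP; rewrite -subr_eq0 => h3 /eqP; rewrite -subr_eq0 => h4.
rewrite /crossing -!(opprB (g1 _)) !upperN //.
have B p q r s u1 u2 u3 u4 :
  p (+) q (+) r (+) s (+) ~~ u1 (+) ~~ u2 (+) ~~ u3 (+) ~~ u4 =
  r (+) s (+) p (+) q (+) u1 (+) u3 (+) u2 (+) u4.
  by move: p q r s u1 u2 u3 u4; do 8! case.
exact: B.
Qed.

(** The terms at the breaking point [g2 d] occur in both summands and cancel. *)
Lemma crossing_addr g1 a b g2 c d e : continuous g2 -> c <= d -> d <= e ->
  (forall t, c <= t <= e -> g2 t <> g1 a) ->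
  (forall t, c <= t <= e -> g2 t <> g1 b) ->
  crossing g1 a b g2 c e = crossing g1 a b g2 c d (+) crossing g1 a b g2 d e.
Proof.
move=> c2 cd de ha hb; rewrite /crossing.
have T x : (forall t, c <= t <= e -> g2 t <> g1 x) -> turn (fun t => g2 t - g1 x) c e =
   turn (fun t => g2 t - g1 x) c d (+) turn (fun t => g2 t - g1 x) d e.
  move=> h; apply: turn_add => //.
    by move=> t; apply: cvgB; [exact: c2|exact: cvg_cst].
  by move=> t tce; rewrite subr_eq0; apply/eqP; exact: h.
rewrite !T //.
have B p q r s1 s2 t1 t2 u1 u2 v1 v2 w1 w2 :
  p (+) q (+) (s1 (+) s2) (+) (t1 (+) t2) (+) u1 (+) v1 (+) u2 (+) v2 =
  p (+) r (+) s1 (+) t1 (+) u1 (+) w1 (+) u2 (+) w2 (+)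
  (r (+) q (+) s2 (+) t2 (+) w1 (+) v1 (+) w2 (+) v2).
  rewrite -[LHS]addbF -(addbb (r (+) w1 (+) w2)).
  by change addb with (@GRing.add bool); ring.
exact: B.
Qed.

End Turn.

(** * Segments in a square and the two sides of a crosscut *)

Section Squares.
Context {R : realType}.
Implicit Types (p q z c x : R * R) (r t : R).

Definition seg p q t : R * R := (p.1 + t * (q.1 - p.1), p.2 + t * (q.2 - p.2)).

Lemma seg0 p q : seg p q 0 = p.
Proof. by case: p => a b; rewrite /seg !mul0r !addr0. Qed.

Lemma seg1 p q : seg p q 1 = q.
Proof. by case: p q => a b [c d]; rewrite /seg !mul1r /= ![_ + (_ - _)]addrC !subrK. Qed.

Lemma continuous_seg p q : continuous (seg p q).
Proof.
have lin (a b : R) : continuous (fun t : R => a + t * b).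
  move=> t; apply: cvgD; first exact: cvg_cst.
  by apply: cvgMr_tmp; exact: cvg_id.
exact: continuous_pair (lin _ _) (lin _ _).
Qed.

Lemma ball_squareE x r z : ball x r z <-> `|x.1 - z.1| < r /\ `|x.2 - z.2| < r.
Proof. by []. Qed.

Lemma seg_ball x r p q t : ball x r p -> ball x r q -> 0 <= t <= 1 ->
  ball x r (seg p q t).
Proof.
move=> /ball_squareE[p1 p2] /ball_squareE[q1 q2] /andP[t0 t1].
apply/ball_squareE; rewrite /seg /=; move: p1 p2 q1 q2.
rewrite !ltr_norml => /andP[? ?] /andP[? ?] /andP[? ?] /andP[? ?].
have lt_conv (a b y : R) : a < y -> b < y -> a + t * (b - a) < y.
  by move=> ay by'; have [|] := leP a b => ?; nra.
have L (a b y : R) : y - r < a -> y - r < b -> a < y + r -> b < y + r ->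
    - r < y - (a + t * (b - a)) /\ y - (a + t * (b - a)) < r.
  move=> h1 h2 h3 h4; have := lt_conv _ _ _ h3 h4.
  have := lt_conv (- a) (- b) (r - y); lra.
have [? ?] : - r < x.1 - (p.1 + t * (q.1 - p.1)) /\ x.1 - (p.1 + t * (q.1 - p.1)) < r.
  by apply: L; lra.
have [? ?] : - r < x.2 - (p.2 + t * (q.2 - p.2)) /\ x.2 - (p.2 + t * (q.2 - p.2)) < r.
  by apply: L; lra.
by split; apply/andP.
Qed.

(** Balls are squares, so that one of the four sides of the square separates it from [c]. *)
Lemma ball_half x r c : ~ ball x r c ->
  exists w, forall z, ball x r z -> 0 < dot w (z - c).
Proof.
move=> nb.
have : ~~ ((`|x.1 - c.1| < r) && (`|x.2 - c.2| < r)).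
  by apply/negP => /andP[? ?]; apply: nb.
rewrite negb_and -!leNgt !ler_normr => /orP[|] /orP[] h.
- by exists (1, 0) => z [z1 _]; move: z1; rewrite /ball /= /dot /= ltr_norml => /andP[? ?]; lra.
- by exists (- 1, 0) => z [z1 _]; move: z1; rewrite /ball /= /dot /= ltr_norml => /andP[? ?]; lra.
- by exists (0, 1) => z [_ z1]; move: z1; rewrite /ball /= /dot /= ltr_norml => /andP[? ?]; lra.
- by exists (0, - 1) => z [_ z1]; move: z1; rewrite /ball /= /dot /= ltr_norml => /andP[? ?]; lra.
Qed.

End Squares.

Section Sides.
Context {R : realType} (f : R -> R * R) (cf : continuous f) (x0 : R * R) (r : R).
Context (r0 : 0 < r).
Implicit Types (u v : R) (z : R * R).
Notation D := (ball x0 r).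

Definition off u v z := forall t, u <= t <= v -> f t <> z.

(** The parity of the crossings of the path with a segment from a reference point to [z],
    up to a constant: when the ends of the path are outside the square, the terms of
    [crossing] at these ends depend on the ends of the segment only. *)
Definition side u v z : bool :=
  turn (fun t => f t - z) u v (+) upper (f u - z) (+) upper (f v - z)
  (+) flip (x0 - f u) (z - f u) (+) flip (x0 - f v) (z - f v).

(** Seen from a point outside the square, a segment inside stays in a half-plane, so that
    its turning parity is determined by its ends. *)
Lemma crossing_side u v p q : ~ D (f u) -> ~ D (f v) -> D p -> D q ->
  crossing (seg p q) 0 1 f u v = side u v p (+) side u v q.
Proof.
move=> hu hv Dp Dq; rewrite /crossing /side.
have T c : ~ D c -> turn (fun t => seg p q t - c) 0 1 =
    flip (x0 - c) (p - c) (+) flip (x0 - c) (q - c).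
  move=> /ball_half[w hw].
  rewrite (@turn_half _ w) ?ler01 //; last by move=> t t01; apply: hw; exact: seg_ball.
  rewrite seg0 seg1 [flip (x0 - c) _]flipC.
  by apply: (@flip_cocycle _ w); apply: hw => //; exact: ballxx.
rewrite !T // seg0 seg1; change addb with (@GRing.add bool); ring.
Qed.

Lemma side_seg u v p q : u <= v -> ~ D (f u) -> ~ D (f v) -> D p -> D q ->
  (forall t, 0 <= t <= 1 -> off u v (seg p q t)) -> side u v p = side u v q.
Proof.
move=> uv hu hv Dp Dq hoff; apply/eqP; rewrite -[_ == _]negbK -negb_add negbK.
rewrite -crossing_side // crossing_disjoint //; first exact: continuous_seg.
by move=> s t s01 tuv /esym; exact: hoff.
Qed.

Lemma near_off u v z : off u v z -> \forall y \near z, off u v y.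
Proof.
move=> hz.
have cl : closed (f @` `[u, v]).
  apply: compact_closed; first exact: norm_hausdorff.
  apply: continuous_compact; last exact: segment_compact.
  by apply: continuous_subspaceT => t; exact: cf.
have : nbhs z (~` (f @` `[u, v])).
  apply: open_nbhs_nbhs; split; first exact: closed_openC.
  by move=> [t]; rewrite /= in_itv /= => tuv; exact: hz.
by apply: filterS => y hy t tuv e; apply: hy; exists t => //=; rewrite in_itv.
Qed.

Lemma near_side u v z : u <= v -> ~ D (f u) -> ~ D (f v) -> D z -> off u v z ->
  exists2 e, 0 < e & forall y, ball z e y ->
     [/\ D y, off u v y & side u v y = side u v z].
Proof.
move=> uv hu hv Dz hz.
have oD : open D by exact: ball_open.
have nD : nbhs z D by apply: open_nbhs_nbhs.
have : nbhs z (D `&` off u v) by exact: filterI nD (near_off hz).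
move=> /nbhs_ballP[e /= e0 he].
exists e => // y zy.
have [Dy hy] := he y zy; split => //.
apply/esym; apply: side_seg => // t t01.
by have [] := he (seg z y t) (seg_ball (ballxx _ e0) zy t01).
Qed.

Lemma side_path u v a b : u <= v -> ~ D (f u) -> ~ D (f v) -> a <= b ->
  (forall t, a <= t <= b -> D (f t)) -> (forall t, a <= t <= b -> off u v (f t)) ->
  forall t, a <= t <= b -> side u v (f t) = side u v (f a).
Proof.
move=> uv hu hv ab hD hoff; apply: locally_constant_itv => // t tab.
have [e e0 he] := near_side uv hu hv (hD _ tab) (hoff _ tab).
have : \forall s \near t, ball (f t) e (f s).
  exact: cf t _ (nbhsx_ballx (f t) e e0).
by apply: filterS => s /he[].
Qed.

End Sides.

(** * Passes of a path through a square *)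

Section Exit.
Context {R : realType}.

(** The exit time is the infimum of the later times spent outside the open set. *)
Lemma first_exit (T : topologicalType) (f : R -> T) (O : set T) (t b : R) :
  continuous f -> open O -> t <= b -> O (f t) -> ~ O (f b) ->
  exists v, [/\ t < v, v <= b, ~ O (f v) & forall s, t <= s -> s < v -> O (f s)].
Proof.
move=> cf oO tb Ot nOb.
pose S := [set s | t <= s /\ ~ O (f s)].
have hS : has_inf S by split; [exists b|exists t => s []].
have nO : ~ O (f (inf S)).
  move=> Oi; have : nbhs (inf S) (f @^-1` O) by apply: cf; exact: open_nbhs_nbhs.
  move=> /near_itv[d d0 hd].
  have [s [ts nOs] sd] := inf_adherent d0 hS.
  have is0 : inf S <= s by apply: ge_inf; [case: hS|].
  apply: nOs; apply: hd.
  rewrite ler0_norm ?subr_le0 //.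
  by rewrite opprB; lra.
have ti : t <= inf S by apply: lb_le_inf; [case: hS|move=> s []].
exists (inf S); split => //.
- by rewrite lt_neqAle ti andbT; apply/eqP => e; apply: nO; rewrite -e.
- by apply: ge_inf; [case: hS|].
- move=> s ts si; apply: contrapT => nOs; move: si; apply/negP; rewrite -leNgt.
  by apply: ge_inf; [case: hS|].
Qed.

Lemma last_entrance (T : topologicalType) (f : R -> T) (O : set T) (t a : R) :
  continuous f -> open O -> a <= t -> O (f t) -> ~ O (f a) ->
  exists u, [/\ u < t, a <= u, ~ O (f u) & forall s, u < s -> s <= t -> O (f s)].
Proof.
move=> cf oO aT Ot nOa.
have cN : continuous (f \o -%R).
  by move=> s; apply: continuous_comp; [exact: opp_continuous|exact: cf].
have [||/=|v [h1 h2 h3 h4]] := @first_exit T (f \o -%R) O (- t) (- a) cN oO.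
- by rewrite lerN2.
- by rewrite /= opprK.
- by rewrite opprK.
exists (- v); split => //; [lra|lra|move=> s us st].
by have := h4 (- s); rewrite /= opprK; apply; lra.
Qed.

End Exit.

Section Passes.
Context {R : realType} (f : R -> R * R) (cf : continuous f) (x0 : R * R) (r : R).
Context (r0 : 0 < r).
Notation D := (ball x0 r).

(** The interval ]u, v[ is a component of the set of times spent in the square, and the
    path makes a crosscut of the square. *)
Definition pass u v := [/\ 0 <= u, u < v, ~ D (f u), ~ D (f v) &
  forall t, u < t -> t < v -> D (f t)].

Lemma pass_exists s t b : 0 <= s -> s <= t -> t <= b ->
  ~ D (f s) -> D (f t) -> ~ D (f b) ->
  exists u v, [/\ pass u v, s <= u, u < t, t < v & v <= b].
Proof.
move=> s0 st tb nDs Dt nDb.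
have oD : open D by exact: ball_open.
have [v [tv vb nDv hv]] := first_exit cf oD tb Dt nDb.
have [u [ut su nDu hu]] := last_entrance cf oD st Dt nDs.
exists u, v; split; [|exact: su|exact: ut|exact: tv|exact: vb].
split; [exact: le_trans s0 su|exact: lt_trans ut tv|exact: nDu|exact: nDv|].
move=> x ux xv; have [xt|/ltW tx] := leP x t; [exact: hu|exact: hv].
Qed.

(** An end of one pass inside the other would be a time both inside and outside the
    square. *)
Lemma pass_disjoint u v u' v' : pass u v -> pass u' v' ->
  [\/ u = u' /\ v = v', v <= u' | v' <= u].
Proof.
move=> [_ uv nu nv h] [_ uv' nu' nv' h'].
have [|u'v] := leP v u'; first by constructor 2.
have [|uv''] := leP v' u; first by constructor 3.
constructor 1; split; apply/eqP; rewrite eq_le; apply/andP; split; rewrite leNgt; apply/negP => lt.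
- by apply: nu; apply: h'.
- by apply: nu'; apply: h.
- by apply: nv'; apply: h.
- by apply: nv; apply: h'.
Qed.

(** A segment inside the square is only met during passes, and each pass crosses it as
    many times, modulo 2, as the change of side between its ends. *)
Lemma crossing_passes p q s t : 0 <= s -> s <= t -> ~ D (f s) -> ~ D (f t) ->
  D p -> D q -> off f s t p -> off f s t q ->
  (forall u v, pass u v -> s <= u -> v <= t -> side f x0 u v p = side f x0 u v q) ->
  crossing (seg p q) 0 1 f s t = false.
Proof.
move=> s0 st nDs nDt Dp Dq offp offq hside.
have oD : open D by exact: ball_open.
have add a b c : s <= a -> a <= b -> b <= c -> c <= t ->
    crossing (seg p q) 0 1 f a c = crossing (seg p q) 0 1 f a b (+) crossing (seg p q) 0 1 f b c.
  move=> sa ab bc ct; apply: crossing_addr => // x /andP[ax xc]; rewrite ?seg0 ?seg1.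
    by apply: offp; rewrite (le_trans sa) //= (le_trans xc).
  by apply: offq; rewrite (le_trans sa) //= (le_trans xc).
suff : forall a b, s <= a -> a <= b -> b <= t -> ~ D (f a) -> ~ D (f b) ->
    crossing (seg p q) 0 1 f a b = false by apply.
apply: (@cousin R s t (fun c d => forall a b, c <= a -> a <= b -> b <= d ->
   ~ D (f a) -> ~ D (f b) -> crossing (seg p q) 0 1 f a b = false)) => //; last first.
  move=> c m d sc cm md dt hc hd a b ca ab bd nDa nDb.
  have [am|ma] := leP a m; last by apply: hd => //; exact: ltW.
  have [bm|mb] := leP b m; first by apply: hc.
  have sa : s <= a := le_trans sc ca.
  have bt : b <= t := le_trans bd dt.
  have [Dm|nDm] := pselect (D (f m)); last first.
    by rewrite (add a m b sa am (ltW mb) bt) (hc a m) // (hd m b) // ltW.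
  have [u [v [uvp au um mv vb]]] := pass_exists (le_trans s0 sa) am (ltW mb) nDa Dm nDb.
  have [_ uv nDu nDv _] := uvp.
  have ub : u <= b := ltW (lt_le_trans uv vb).
  have su : s <= u := le_trans sa au.
  rewrite (add a u b) // (add u v b) // ?(ltW uv) //.
  rewrite (hc a u) ?(ltW um) // (hd v b) ?(ltW mv) // addFb addbF.
  rewrite (@crossing_side _ f x0 r r0) // hside ?addbb //.
  exact: le_trans vb bt.
move=> x /andP[sx xt]; have [Dx|nDx] := pselect (D (f x)).
  have : nbhs x (f @^-1` D) by apply: cf; exact: open_nbhs_nbhs.
  move=> /near_itv[d d0 hd]; exists d => // c e sc cx xe et ed a b ca ab be nDa nDb.
  exfalso; apply: nDa; apply: hd; rewrite ltr_norml; apply/andP; split; lra.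
have : off (seg p q) 0 1 (f x).
  by move=> y y01 e; apply: nDx; rewrite -e; exact: seg_ball.
move=> /(near_off (@continuous_seg _ p q))/cf/near_itv[d d0 hd].
exists d => // c e sc cx xe et ed a b ca ab be _ _.
apply: crossing_disjoint => //; first exact: continuous_seg.
move=> y z y01 /andP[az zb]; apply: hd => //; rewrite ltr_norml; apply/andP; split; lra.
Qed.

End Passes.

(** * K_{3,3} has no drawing in which independent edges cross evenly *)

Section NonPlanar.
Context {R : realType} (f : R -> R * R) (cf : continuous f).
Context (cen : 'I_3 -> R * R) (r : 'I_3 -> R) (r0 : forall j, 0 < r j).
Notation D j := (ball (cen j) (r j)).
Context (p : 'I_3 -> R * R) (s : 'I_3 -> R) (tau : 'I_3 -> 'I_3 -> R).
Notation b i := (f (s i)).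
Notation q j i := (f (tau j i)).
Context (disj : forall j k z, j != k -> D j z -> ~ D k z)
  (Dp : forall j, D j (p j)) (Dq : forall j i, D j (q j i))
  (nDb : forall j i, ~ D j (b i))
  (s_ge0 : forall i, 0 <= s i) (s_le : forall j i, s i <= tau j i)
  (offp : forall j k i, off f (s i) (tau k i) (p j))
  (apart : forall i l j k x, i != l -> s i <= x <= tau j i -> off f (s l) (tau k l) (f x))
  (sides : forall j i u v, pass f (cen j) (r j) u v ->
     off f u v (p j) -> off f u v (q j i) ->
     side f (cen j) u v (p j) = side f (cen j) u v (q j i)).

Let edge_turn c j i :=
  turn (fun t => seg (p j) (q j i) t - c) 0 1 (+) turn (fun t => f t - c) (s i) (tau j i).

(** The edge from [p j] to [b i] is the segment from [p j] to [q j i] followed by the path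
    back to [b i].  The crossing parity of two independent edges is the sum of the
    parities of their pieces, which all vanish.  The terms at the intermediate points
    [q j i] and [q k l] cancel in this sum, leaving the terms at the four vertices. *)
Lemma edge_relation j k i l : j != k -> i != l ->
  edge_turn (p k) j i (+) edge_turn (b l) j i
  (+) edge_turn (p j) k l (+) edge_turn (b i) k l
  (+) upper (p k - p j) (+) upper (b l - p j)
  (+) upper (p k - b i) (+) upper (b l - b i) = false.
Proof.
move=> jk il.
have seg_path a c d e : a != c -> d != e ->
    crossing (seg (p a) (q a d)) 0 1 f (s e) (tau c e) = false.
  move=> ac de.
  have offq : off f (s e) (tau c e) (q a d) by apply: (apart (j := a) de); rewrite s_le lexx.
  apply: (crossing_passes cf (r0 a)) => //.
    by apply: (disj (j := c)); rewrite // eq_sym.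
  move=> u v uvp su vt.
  have sub z : off f (s e) (tau c e) z -> off f u v z.
    by move=> h t /andP[ut tv]; apply: h; rewrite (le_trans su) //= (le_trans tv).
  by apply: sides => //; exact: sub.
have C1 : crossing (seg (p j) (q j i)) 0 1 (seg (p k) (q k l)) 0 1 = false.
  apply: crossing_disjoint; rewrite ?ler01 //; try exact: continuous_seg.
  move=> x y x01 y01 e; apply: (@disj j k (seg (p j) (q j i) x) jk).
    exact: seg_ball.
  by rewrite e; exact: seg_ball.
have C2 := seg_path j k i l jk il.
have C3 : crossing f (s i) (tau j i) (seg (p k) (q k l)) 0 1 = false.
  have [ne1 ne2] : p k <> b i /\ p k <> q j i.
    by split=> e; [apply: (@offp k j i (s i))|apply: (@offp k j i (tau j i))]; rewrite ?lexx ?s_le.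
  have li : l != i by rewrite eq_sym.
  have [ne3 ne4] : q k l <> b i /\ q k l <> q j i.
    split=> e; [apply: (@apart l i k j (tau k l) li _ (s i))|
                apply: (@apart l i k j (tau k l) li _ (tau j i))]; by rewrite ?lexx ?s_le.
  rewrite crossing_sym ?seg0 ?seg1; try by move=> /esym.
  by apply: seg_path; rewrite eq_sym.
have C4 : crossing f (s i) (tau j i) f (s l) (tau k l) = false.
  apply: crossing_disjoint => // x y xi yl /esym; exact: apart xi _ yl.
have : crossing (seg (p j) (q j i)) 0 1 (seg (p k) (q k l)) 0 1
  (+) crossing (seg (p j) (q j i)) 0 1 f (s l) (tau k l)
  (+) crossing f (s i) (tau j i) (seg (p k) (q k l)) 0 1
  (+) crossing f (s i) (tau j i) f (s l) (tau k l) = false.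
  by rewrite C1 C2 C3 C4.
rewrite /crossing /edge_turn !seg0 !seg1 => <-.
set t1 := turn (fun t => seg (p j) (q j i) t - q k l) 0 1.
set t2 := turn (fun t => seg (p k) (q k l) t - q j i) 0 1.
set t3 := turn (fun t => f t - q j i) (s l) (tau k l).
set t4 := turn (fun t => f t - q k l) (s i) (tau j i).
set u1 := upper (q k l - p j); set u2 := upper (p k - q j i).
set u3 := upper (q k l - q j i); set u4 := upper (b l - q j i).
set u5 := upper (q k l - b i).
(* The terms at the intermediate points, each of which is counted twice. *)
pose m := t1 (+) t2 (+) t3 (+) t4 (+) u1 (+) u2 (+) (u3 (+) u3) (+) u4 (+) u5.
rewrite -[LHS]addbF -(addbb m) /m; change addb with (@GRing.add bool); ring.
Qed.

(** Fix [j <> k] and add the relations of all pairs [i <> l].  Every term appears twice,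
    except that [upper (b i - b l)] and its negation sum to 1 for each of the three pairs
    of vertices [b], and that the turning parities around the [b l] group into one
    quantity [beta] for each of [j] and [k].  So [beta j] and [beta k] differ, for any
    two of three indices: impossible for booleans. *)
Lemma k33_not_planar : False.
Proof.
pose i0 : 'I_3 := ord0; pose i1 : 'I_3 := lift ord0 ord0; pose i2 : 'I_3 := ord_max.
pose B l j i := edge_turn (b l) j i.
pose beta j := B i0 j i1 (+) B i1 j i0 (+) B i0 j i2 (+) B i2 j i0 (+) B i1 j i2 (+) B i2 j i1.
have H j k : j != k -> beta j = ~~ beta k.
  move=> jk.
  pose e i l := edge_turn (p k) j i (+) B l j i (+) edge_turn (p j) k l (+) B i k l
    (+) upper (p k - p j) (+) upper (b l - p j) (+) upper (p k - b i) (+) upper (b l - b i).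
  have E i l : i != l -> e i l = false by exact: edge_relation.
  have ub i l : i != l -> upper (b i - b l) = true (+) upper (b l - b i).
    move=> il; rewrite addTb -(opprB (b l)) upperN // subr_eq0; apply/eqP => eil.
    have li : l != i by rewrite eq_sym.
    by apply: (@apart l i j j (s l) li _ (s i)); rewrite ?lexx ?s_le.
  pose P i := edge_turn (p k) j i (+) edge_turn (p j) k i
     (+) upper (b i - p j) (+) upper (p k - b i) (+) upper (p k - p j).
  pose U := upper (b i1 - b i0) (+) upper (b i2 - b i0) (+) upper (b i2 - b i1) (+) true.
  pose m := P i0 (+) P i1 (+) P i2 (+) U.
  suff : beta j (+) beta k (+) true = false by case: (beta j); case: (beta k).
  transitivity (e i0 i1 (+) e i1 i0 (+) e i0 i2 (+) e i2 i0 (+) e i1 i2 (+) e i2 i1);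
    last by rewrite !E.
  rewrite /e (ub i0 i1 isT) (ub i0 i2 isT) (ub i1 i2 isT).
  rewrite -[LHS]addbF -(addbb m) /m /P /U /beta; change addb with (@GRing.add bool).
  ring.
have := H i0 i1 isT; rewrite (H i1 i2 isT) negbK => e.
by have := H i0 i2 isT; rewrite e; case: (beta i2).
Qed.

End NonPlanar.

(** * Upper limits of sequences of sets *)

Section Limits.
Context {R : realType}.

Lemma compact_closed_ball (z : R * R) e : 0 < e -> compact (closed_ball z e).
Proof.
move=> e0.
apply: (@subclosed_compact _ _ (`[z.1 - e, z.1 + e] `*` `[z.2 - e, z.2 + e])).
- exact: closed_ball_closed.
- by apply: compact_setX; exact: segment_compact.
- rewrite closed_ballE // /closed_ball_ => y /=.
  rewrite prod_normE ge_max !ler_norml /= !in_itv /= => /andP[/andP[? ?] /andP[? ?]].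
  by split; apply/andP; split; lra.
Qed.

Lemma compact_seq (T : topologicalType) (C : set T) (y : nat -> T) :
  compact C -> (forall n, C (y n)) ->
  exists2 c, C c & forall N (F : set T), closed F ->
    (forall n, (N <= n)%N -> F (y n)) -> F c.
Proof.
move=> cC Cy.
have [|c [Cc hc]] := cC (y @ \oo) _; first by exists 0%N => // n _; exact: Cy.
exists c => // N F cF Fy; apply: cF => B /hc; apply.
by exists N => // n /= Nn; exact: Fy.
Qed.

(** The upper limit of a sequence of sets in the sense of Kuratowski. *)
Definition limsup_set (T : topologicalType) (A : nat -> set T) : set T :=
  \bigcap_N closure (\bigcup_(n in [set n | (N <= n)%N]) A n).

Lemma closed_limsup_set (T : topologicalType) (A : nat -> set T) : closed (limsup_set A).
Proof. by apply: closed_bigI => N _; exact: closed_closure. Qed.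

Lemma limsup_set_seq (T : topologicalType) (A : nat -> set T) (C : set T)
    (k : nat -> nat) (y : nat -> T) : compact C -> (forall n, C (y n)) ->
  (forall n, (n <= k n)%N) -> (forall n, A (k n) (y n)) -> exists2 c, C c & limsup_set A c.
Proof.
move=> cC Cy nk Ay; have [c Cc hc] := compact_seq cC Cy.
exists c => // N _; apply: (hc N); first exact: closed_closure.
move=> n Nn; apply: subset_closure; exists (k n) => //=.
exact: leq_trans Nn (nk n).
Qed.

Lemma limsup_set_sub (T : topologicalType) (A : nat -> set T) (F : set T) N :
  closed F -> (forall n, (N <= n)%N -> A n `<=` F) -> limsup_set A `<=` F.
Proof.
move=> cF AF y /(_ N I); move/closure_id: cF => ->; apply: closure_subset.
by move=> x [n Nn]; exact: AF.
Qed.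

Lemma limsup_set_cvg (T : topologicalType) (A : nat -> set T) (x : nat -> T) z :
  (forall n, A n (x n)) -> x @ \oo --> z -> limsup_set A z.
Proof.
move=> Ax xz N _ B zB.
have : \forall n \near \oo, B (x n) by apply: xz.
move=> [M _ hM]; exists (x (maxn M N)); split; last by apply: hM; exact: leq_maxl.
by exists (maxn M N) => //=; exact: leq_maxr.
Qed.

(** If the upper limit splits into disjoint closed sets, put disjoint open sets around
    them.  By compactness they eventually cover the [A n], which are connected and
    therefore all lie in the one that contains [z]; the other part is empty. *)
Lemma connected_limsup_set (C : set (R * R)) (A : nat -> set (R * R)) (x : nat -> R * R)
    (z : R * R) :
  compact C -> (forall n, A n `<=` C) -> (forall n, connected (A n)) ->
  (forall n, A n (x n)) -> x @ \oo --> z ->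
  connected (limsup_set A).
Proof.
move=> cC AC cA Ax xz.
have K_z := limsup_set_cvg Ax xz.
have cK := @closed_limsup_set _ A.
suff H P Q : closed P -> closed Q -> P `&` Q = set0 -> limsup_set A = P `|` Q -> P z ->
    Q = set0.
  move=> B B0 [G oG BG] [F cF BF].
  have cB : closed B by rewrite BF; exact: closedI.
  have cB' : closed (limsup_set A `&` ~` G).
    by apply: closedI => //; exact: open_closedC.
  have U : limsup_set A = B `|` (limsup_set A `&` ~` G).
    by rewrite BG -setIUr setUv setIT.
  have I0 : B `&` (limsup_set A `&` ~` G) = set0.
    by rewrite BG setIACA setICr setI0.
  have [Bz|nBz] := pselect (B z).
    by rewrite U (H B _ cB cB' I0 U Bz) setU0.
  have := H _ _ cB' cB; rewrite setIC => /(_ I0); rewrite setUC => /(_ U) h.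
  case: B0 => b; rewrite h //.
  by have [] : (B `|` (limsup_set A `&` ~` G)) z by rewrite -U.
move=> cP cQ PQ U Pz.
have [V [W [oV oW PV QW VW]]] := (@normal_openP R _).1 (@pseudometric_normal R (R * R)%type) P Q cP cQ PQ.
have [N hN] : exists N, forall n, (N <= n)%N -> A n `<=` V `|` W.
  apply: contrapT => /forallNP h.
  have /choice[k hk] : forall N, exists n, (N <= n)%N /\ ~ A n `<=` V `|` W.
    by move=> N; have /existsNP[n /not_implyP[]] := h N; exists n.
  have /choice[y hy] : forall n, exists y, A (k n) y /\ ~ (V `|` W) y.
    by move=> n; have [_ /existsNP[y /not_implyP[]]] := hk n; exists y.
  have cCV : compact (C `&` ~` (V `|` W)).
    by apply: compact_closedI => //; apply: open_closedC; exact: openU.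
  have [n|n|n|c [_ nVW] Kc] := @limsup_set_seq _ A _ k y cCV.
  - by have [Ay ?] := hy n; split => //; exact: AC Ay.
  - by have [] := hk n.
  - by have [] := hy n.
  - by apply: nVW; move: Kc; rewrite U => -[/PV|/QW]; [left|right].
have [M hM] : exists M, forall n, (M <= n)%N -> V (x n).
  have : \forall n \near \oo, V (x n) by apply: xz; apply: open_nbhs_nbhs; split => //; exact: PV.
  by move=> [M _ hM]; exists M => n Mn; exact: hM.
have AV n : (maxn N M <= n)%N -> A n `<=` V.
  rewrite geq_max => /andP[Nn Mn].
  have <- : A n `&` V = A n; last exact: subIsetr.
  apply: (cA n); first by exists (x n); split; [exact: Ax|exact: hM].
  - by exists V.
  - exists (~` W); first exact: open_closedC.
    apply/seteqP; split => a [Aa h]; split => //.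
      by move=> Wa; have : (V `&` W) a by []; rewrite VW.
    by case: (hN n Nn a Aa).
have KV : limsup_set A `<=` ~` W.
  apply: (@limsup_set_sub _ _ _ (maxn N M)); first exact: open_closedC.
  by move=> n /AV AV' a /AV' Va Wa; have : (V `&` W) a by []; rewrite VW.
apply/seteqP; split => // a Qa; apply: (KV a); last exact: QW.
by rewrite U; right.
Qed.

End Limits.

(** * One-sided continua in the closure of the ray *)

Section SideContinuum.
Context {R : realType} (f : R -> R * R) (cf : continuous f).
Context (inj : forall s t : R, 0 <= s -> 0 <= t -> f s = f t -> s = t).
Context (x0 : R * R) (r : R) (r0 : 0 < r).
Notation D := (ball x0 r).
Notation X := (f @` [set t : R | 0 <= t]).
Context (exitD : forall T, exists2 t, T <= t & ~ D (f t)).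

Lemma off_notin u v z : ~ X z -> 0 <= u -> off f u v z.
Proof. by move=> nX u0 t /andP[ut _] e; apply: nX; exists t => //=; exact: le_trans ut. Qed.

Lemma off_inj u v t : 0 <= u -> v < t -> off f u v (f t).
Proof.
move=> u0 vt s /andP[us sv] e; have s0 := le_trans u0 us.
have st := le_lt_trans sv vt.
have E : s = t by apply: inj => //; exact: le_trans s0 (ltW st).
by rewrite E ltxx in st.
Qed.

Lemma closure_exit (z : R * R) e a b : a < b -> (forall s, a <= s -> s < b -> ball z e (f s)) ->
  forall s, a <= s <= b -> closed_ball z e (f s).
Proof.
move=> ab h s /andP[aS]; rewrite le_eqVlt => /orP[/eqP -> B|sb]; last first.
  by apply: subset_closed_ball; exact: h.
move=> /cf/near_itv[d d0 hd].
pose x := Num.max a (b - d / 2).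
have ax : a <= x by rewrite le_max lexx.
have xb : x < b by rewrite gt_max ab /=; lra.
have dx : b - d / 2 <= x by rewrite le_max lexx orbT.
by exists (f x); split; [exact: h|apply: hd; rewrite ger0_norm; lra].
Qed.

Lemma connected_path a b : connected (f @` [set t | a <= t <= b]).
Proof.
have -> : [set t | a <= t <= b] = [set` `[a, b]] by apply/seteqP; split => t /=; rewrite in_itv.
apply: connected_continuous_connected; first exact: segment_connected.
by apply: continuous_subspaceT => t; exact: cf.
Qed.

(** A point outside the ray is at positive distance from each arc [f ([0, n])]. *)
Lemma late_times z : closure X z -> ~ X z -> forall (n : nat) e, 0 < e ->
  exists t, [/\ 0 <= t, n%:R < t & ball z e (f t)].
Proof.
move=> Xz nXz n e e0.
have nb : nbhs z (ball z e `&` off f 0 n%:R).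
  apply: filterI; first exact: nbhsx_ballx.
  by apply: (near_off cf); exact: off_notin.
have [_ [[t /= t0 <-] [zt ot]]] := Xz _ nb.
exists t; split => //; rewrite ltNge; apply/negP => tn.
by apply: (ot t) => //; rewrite t0.
Qed.

(** Follow the ray from times [t n] at which it is closer and closer to [z] until it leaves
    a small square around [z], and take the upper limit of these pieces.  A given pass
    occurs before [t n] for large [n], so the pieces miss it and stay on the side of
    [z].  The exit points accumulate at a second point of the continuum. *)
Lemma side_continuum z : closure X z -> ~ X z -> D z ->
  exists K : set (R * R), [/\ K `<=` closure X, compact K /\ connected K, non_degenerate K,
    K z /\ K `<=` D &
    forall u v y, pass f x0 r u v -> K y -> off f u v y ->
      side f x0 u v y = side f x0 u v z].
Proof.
move=> Xz nXz Dz.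
have oD : open D by exact: ball_open.
have /nbhs_ballP[e /= e0 he] : nbhs z D by apply: open_nbhs_nbhs.
have e20 : 0 < e / 2 by lra.
have hO : closed_ball z (e / 2) `<=` D.
  by apply: subset_trans he; exact: subset_closure_half.
have /choice[t ht] : forall n : nat, exists t, [/\ 0 <= t, n%:R < t, ball z (e / 2) (f t)
     & ball z n.+1%:R^-1 (f t)].
  move=> n; have m0 : 0 < Num.min (e / 2) n.+1%:R^-1 by rewrite lt_min e20 /= invr_gt0.
  have [t [t0 nt zt]] := late_times Xz nXz n m0.
  exists t; split => //; apply: le_ball zt; rewrite ge_min lexx ?orbT //.
have /choice[w hw] : forall n, exists w, [/\ t n < w, ~ ball z (e / 2) (f w) &
    forall s, t n <= s -> s < w -> ball z (e / 2) (f s)].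
  move=> n; have [t0 nt zt _] := ht n; have [T tT nDT] := exitD (t n).
  have oB : open (ball z (e / 2)) by exact: ball_open.
  have nB : ~ ball z (e / 2) (f T).
    by move=> h; apply: nDT; apply: hO; exact: subset_closed_ball.
  by have [w [? ? ? ?]] := first_exit cf oB tT zt nB; exists w.
pose A n := f @` [set s | t n <= s <= w n].
pose K := limsup_set A; pose C := closed_ball z (e / 2).
have cC : compact C by exact: compact_closed_ball.
have clC : closed C by exact: closed_ball_closed.
have AC n : A n `<=` C.
  move=> _ [s /= hs <-]; have [tw _ h] := hw n; exact: closure_exit tw h s hs.
have At n : A n (f (t n)) by exists (t n) => //=; rewrite lexx; have [/ltW] := hw n.
have tz : f \o t @ \oo --> z.
  move=> B /nbhs_ballP[d /= d0 hB].
  have [N _ hN] := near_infty_natSinv_lt (PosNum d0).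
  exists N => // n /hN /= nd; apply: hB; have [_ _ _ h] := ht n.
  by apply: le_ball h; exact: ltW.
have KC : K `<=` C by apply: (@limsup_set_sub _ _ _ 0%N).
have Kz : K z by exact: limsup_set_cvg At tz.
exists K; split.
- apply: limsup_set_sub 0%N _ _; first exact: closed_closure.
  move=> n _ _ [s /= /andP[ts _] <-]; apply: subset_closure; exists s => //=.
  by have [t0 _ _ _] := ht n; exact: le_trans ts.
- split; first by apply: (subclosed_compact _ cC KC); exact: closed_limsup_set.
  by apply: (connected_limsup_set cC AC _ At tz) => n; exact: connected_path.
- have cCB : compact (C `&` ~` ball z (e / 2)).
    by apply: compact_closedI => //; apply: open_closedC; exact: ball_open.
  have [||n|y [_ nzy] Ky] := @limsup_set_seq _ A _ id (f \o w) cCB.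
  + move=> n; have [tw nB _] := hw n; split => //; apply: (AC n).
    by exists (w n) => //=; rewrite lexx ltW.
  + by [].
  + by exists (w n) => //=; rewrite lexx; have [/ltW ->] := hw n.
  + by exists z, y; split => // zy; apply: nzy; rewrite -zy; exact: ballxx.
- by split => // y /KC /hO.
- move=> u v y uvp Ky offy; have [u0 uv nDu nDv _] := uvp.
  have offz : off f u v z by exact: off_notin.
  have [d d0 hd] := near_side cf r0 (ltW uv) nDu nDv Dz offz.
  have [d' d'0 hd'] := near_side cf r0 (ltW uv) nDu nDv (hO _ (KC _ Ky)) offy.
  have [N1 _ hN1] : \forall n \near \oo, ball z d (f (t n)) by apply: tz; exact: nbhsx_ballx.
  have [N2 hN2] : exists N, forall n, (N <= n)%N -> v < t n.
    have [N _ hN] := nbhs_infty_gtr v.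
    by exists N => n /hN /= vn; have [_ nt _ _] := ht n; exact: lt_trans nt.
  have [_ [[n /= Nn [s /= /andP[ts sw] <-]] ys]] :=
    Ky (maxn N1 N2) I _ (nbhsx_ballx y d' d'0).
  move: Nn; rewrite geq_max => /andP[n1 n2].
  have [_ _ <-] := hd' _ ys; have [_ _ <-] := hd _ (hN1 _ n1).
  apply: (side_path cf r0 (ltW uv) nDu nDv (a := t n) (b := w n)).
  + exact: le_trans ts sw.
  + by move=> x hx; apply: hO; apply: (AC n); exists x.
  + move=> x /andP[tx _]; apply: off_inj => //; exact: lt_le_trans (hN2 _ n2) tx.
  + by rewrite ts.
Qed.

End SideContinuum.

(** * Diagonal argument against countable families *)

Section Separation.
Context {R : realType} (f : R -> R * R) (cf : continuous f).
Context (inj : forall s t : R, 0 <= s -> 0 <= t -> f s = f t -> s = t).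
Context (x0 : R * R) (r : R) (r0 : 0 < r).
Notation D := (ball x0 r).
Notation X := (f @` [set t : R | 0 <= t]).
Context (recur : forall (y : R * R) e T, X y -> 0 < e ->
  exists2 t, T < t /\ 0 <= t & ball y e (f t)).
Context (exitD : forall T, exists2 t, T <= t & ~ D (f t)).
Context (mixed : forall (y : R * R) e, X y -> 0 < e -> ball y e `<=` D ->
  exists u v p q, [/\ pass f x0 r u v, X p /\ X q, ball y e p /\ ball y e q,
    off f u v p /\ off f u v q & side f x0 u v p <> side f x0 u v q]).

Definition one_sided (z : R * R) (K : set (R * R)) := forall u v y,
  pass f x0 r u v -> K y -> off f u v y -> side f x0 u v y = side f x0 u v z.

(** Two points of the ray are on different sides of some pass, so one of them is not on the
    prescribed side, nor are the nearby points. *)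
Lemma mixed_avoid (y : R * R) e (k : R -> R -> bool) : X y -> 0 < e -> ball y e `<=` D ->
  exists u v p d, [/\ pass f x0 r u v, X p, 0 < d, ball p d `<=` ball y e &
    (forall z, ball p d z -> off f u v z /\ side f x0 u v z != k u v)].
Proof.
move=> Xy e0 yD; have [u [v [p [q [uvp [Xp Xq] [yp yq] [op oq] pq]]]]] := mixed Xy e0 yD.
have [u0 uv nDu nDv _] := uvp.
have H p' : X p' -> ball y e p' -> off f u v p' -> side f x0 u v p' != k u v ->
    exists u v p d, [/\ pass f x0 r u v, X p, 0 < d, ball p d `<=` ball y e &
    (forall z, ball p d z -> off f u v z /\ side f x0 u v z != k u v)].
  move=> Xp' yp' op' kp'.
  have [d d0 hd] := near_side cf r0 (ltW uv) nDu nDv (yD _ yp') op'.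
  have : nbhs p' (ball y e) by apply: open_nbhs_nbhs; split => //; exact: ball_open.
  move=> /nbhs_ballP[d' /= d'0 hd'].
  have m0 : 0 < Num.min d d' by rewrite lt_min d0.
  exists u, v, p', (Num.min d d'); split => //.
    by move=> z zb; apply: hd'; apply: le_ball zb; rewrite ge_min lexx orbT.
  move=> z zb; have [|_ ? ->] := hd z; last by [].
  by apply: le_ball zb; rewrite ge_min lexx.
have [pk|pk] := eqVneq (side f x0 u v p) (k u v); last exact: (H p).
by apply: (H q) => //; rewrite -pk; apply/eqP => /esym.
Qed.

(** A first pass separates a smaller square from [z0], and a second one separates a still
    smaller square from the first pass.  A one-sided continuum through the last square
    cannot cross the second pass, hence misses the first one, hence misses [K0]. *)
Lemma separate (y : R * R) e z0 K0 : X y -> 0 < e -> ball y e `<=` D ->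
  one_sided z0 K0 -> K0 `<=` D ->
  exists p d, [/\ X p, 0 < d, ball p d `<=` ball y e &
    forall z K, ball p d z -> one_sided z K -> K `<=` D -> K `&` K0 = set0].
Proof.
move=> Xy e0 yD hK0 K0D.
have [u1 [v1 [p1 [d1 [pass1 Xp1 d10 b1 h1]]]]] :=
  mixed_avoid (fun u v => side f x0 u v z0) Xy e0 yD.
have [u10 uv1 nDu1 nDv1 in1] := pass1.
have b1D : ball p1 d1 `<=` D by exact: subset_trans b1 yD.
pose m := (u1 + v1) / 2.
(* For the first pass the prescribed value is the one taken on [ball p1 d1], so that the
   second pass is another one; otherwise it is the side that contains the first pass. *)
have [u2 [v2 [p2 [d2 [pass2 Xp2 d20 b2 h2]]]]] :=
  mixed_avoid (fun u v => if `[< u = u1 /\ v = v1 >] then ~~ side f x0 u v z0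
                          else side f x0 u v (f m)) Xp1 d10 b1D.
exists p2, d2; split => //; first exact: subset_trans b2 b1.
move=> z K p2z hK KD.
have [oz sz] := h2 _ p2z; have [oz1 sz1] := h1 _ (b2 _ p2z).
have [u20 uv2 nDu2 nDv2 in2] := pass2.
have ne12 : ~ (u2 = u1 /\ v2 = v1).
  move=> E; move: sz; case: asboolP => // _; case: E => -> ->.
  by move: sz1; case: (side _ _ _ _ z); case: (side _ _ _ _ z0).
move: sz; case: asboolP => // _ sz.
have off2 x : u1 < x -> x < v1 -> off f u2 v2 (f x).
  move=> ux xv s /andP[us sv] fse.
  have sx : s = x by apply: inj => //; [exact: le_trans us|exact: ltW (le_lt_trans u10 ux)].
  by have [[? ?]|h|h] := pass_disjoint pass1 pass2; [exact: ne12|subst; lra|subst; lra].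
have const x : u1 < x -> x < v1 -> side f x0 u2 v2 (f x) = side f x0 u2 v2 (f m).
  have path a b : u1 < a -> b < v1 -> a <= b ->
      side f x0 u2 v2 (f b) = side f x0 u2 v2 (f a).
    move=> ua bv ab; apply: (side_path cf r0 (ltW uv2) nDu2 nDv2 ab) => [t|t|].
    - by move=> /andP[? ?]; apply: in1; lra.
    - by move=> /andP[? ?]; apply: off2; lra.
    - by rewrite ab lexx.
  move=> ux xv; have [xm|/ltW mx] := leP x m; last by apply: path => //; rewrite /m; lra.
  by apply/esym; apply: path => //; rewrite /m; lra.
have K1 x : K x -> off f u1 v1 x.
  move=> Kx t /andP[ut tv] fte.
  have ut' : u1 < t.
    by rewrite lt_neqAle ut andbT; apply/eqP => E; apply: nDu1; rewrite E fte; exact: KD.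
  have tv' : t < v1.
    by rewrite lt_neqAle tv andbT; apply/eqP => E; apply: nDv1; rewrite -E fte; exact: KD.
  move/negP: sz; apply; apply/eqP; rewrite -(const t) // -(hK u2 v2 (f t)) //.
    by rewrite fte.
  exact: off2.
apply/seteqP; split => // x [Kx K0x].
move/negP: sz1; apply; apply/eqP.
by rewrite -(hK u1 v1 x) ?(hK0 u1 v1 x) //; exact: K1.
Qed.

(** This keeps the limit of the nested squares out of the arc [f ([0, n])]. *)
Lemma escape (y : R * R) e (n : nat) : X y -> 0 < e ->
  exists p d, [/\ X p, 0 < d, closed_ball p d `<=` ball y e &
    forall z, closed_ball p d z -> off f 0 n%:R z].
Proof.
move=> Xy e0; have [t [nt t0] yt] := recur n%:R Xy e0.
have ot : off f 0 n%:R (f t) by exact: off_inj.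
have nb : nbhs (f t) (ball y e `&` off f 0 n%:R).
  apply: filterI; last exact: near_off.
  by apply: open_nbhs_nbhs; split => //; exact: ball_open.
move/nbhs_ballP: nb => [d /= d0 hd].
exists (f t), (d / 2); split; [by exists t|lra| |].
  by move=> z /subset_closure_half-/(_ d0)/hd[].
by move=> z /subset_closure_half-/(_ d0)/hd[].
Qed.

(** Take a maximal disjoint family of continua [K z].  If it were countable, nested squares
    could be chosen whose common points [c] lie off every arc of the ray and have
    [K c] disjoint from each member, against maximality. *)
Lemma non_suslinian_mixed : X x0 -> non_suslinian (closure X).
Proof.
move=> Xx0; pose Z := [set z | [/\ closure X z, ~ X z & D z]].
have /choice[K hK] : forall z, exists K : set (R * R), Z z ->
    [/\ K `<=` closure X, compact K /\ connected K, non_degenerate K,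
      K z /\ K `<=` D & one_sided z K].
  move=> z; have [[Xz nXz Dz]|nZ] := pselect (Z z); last by exists set0.
  by have [K hK] := side_continuum cf inj r0 exitD Xz nXz Dz; exists K.
have [E [EZ tE maxE]] := ex_maximal_disjoint_subcollection K Z.
exists (K @` E); split; last first.
- move=> _ _ [z Ez <-] [z' Ez' <-] ne; apply: contrapT => /eqP/set0P zz'.
  by apply: ne; congr K; exact: tE.
- by move=> _ [z /EZ/hK[? ? ? _ _] <-].
move/countable_injP => [j jinj].
pose good (y : R * R) e := [/\ X y, 0 < e & ball y e `<=` D].
(* A state is a step number, the center of a square and its radius. *)
pose next (a b : nat * (R * R) * R) := b.1.1 = a.1.1.+1 /\ (good a.1.2 a.2 ->
  [/\ good b.1.2 b.2, closed_ball b.1.2 b.2 `<=` ball a.1.2 a.2,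
    forall z, closed_ball b.1.2 b.2 z -> off f 0 a.1.1%:R z &
    forall z0 z, E z0 -> j (K z0) = a.1.1 -> closed_ball b.1.2 b.2 z -> Z z ->
      K z `&` K z0 = set0]).
have nextP a : {b | next a b}.
  apply: cid; case: a => -[n y] e.
  have [[/= Xy e0 yD]|ng] := pselect (good y e); last by exists (n.+1, y, e).
  have [p [d [Xp d0 pd hp]]] : exists p d, [/\ X p, 0 < d, ball p d `<=` ball y e &
      forall z0 z, E z0 -> j (K z0) = n -> ball p d z -> Z z -> K z `&` K z0 = set0].
    have [[z0 [Ez0 jz0]]|none] := pselect (exists z0, E z0 /\ j (K z0) = n); last first.
      by exists y, e; split => // z0 z Ez0 jz0; exfalso; apply: none; exists z0.
    have [_ _ _ [_ K0D] h0] := hK _ (EZ _ Ez0).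
    have [p [d [Xp d0 pd hp]]] := separate Xy e0 yD h0 K0D.
    exists p, d; split => // z1 z Ez1 jz1 pz Zz.
    have -> : K z1 = K z0 by apply: jinj; rewrite ?inE ?jz1 ?jz0 //.
    by have [_ _ _ [_ KD] h] := hK _ Zz; exact: hp pz h KD.
  have [p' [d' [Xp' d'0 pd' off']]] := escape n Xp d0.
  exists (n.+1, p', d'); split => // _; split => //=.
  - split => //; apply: subset_trans yD; apply: subset_trans pd.
    by apply: subset_trans pd'; exact: subset_closed_ball.
  - exact: subset_trans pd' pd.
  - by move=> z0 z Ez0 jz0 /pd' pz; exact: hp.
have [a [a0 ha]] := dependent_choice nextP (0%N, x0, r).
have an n : (a n).1.1 = n.
  by elim: n => [|n IH]; [rewrite a0|have [-> _] := ha n; rewrite IH].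
have ga n : good (a n).1.2 (a n).2.
  elim: n => [|n IH]; first by rewrite a0; split.
  by have [_ /(_ IH)[]] := ha n.
pose B n := closed_ball (a n).1.2 (a n).2.
have Bs n : B n.+1 `<=` B n.
  have [_ /(_ (ga n))[_ h _ _]] := ha n.
  by apply: subset_trans h _; exact: subset_closed_ball.
have Bnm n m : (n <= m)%N -> B m `<=` B n.
  move=> /subnK <-; elim: (m - n)%N => [|k IH] //; rewrite addSn.
  exact: subset_trans (Bs _) IH.
have Bc n : B n (a n).1.2 by have [_ e0 _] := ga n; exact: closed_ballxx.
have e10 : 0 < (a 1%N).2 by have [] := ga 1%N.
have [|n|c Cc hc] := @compact_seq _ (B 1%N) (fun n => (a n.+1).1.2).
- exact: compact_closed_ball.
- exact: (Bnm 1%N n.+1).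
have cB n : B n c.
  apply: (hc n); first exact: closed_ball_closed.
  by move=> m nm; apply: (Bnm n m.+1) => //; exact: leqW.
have Zc : Z c.
  split.
  - apply: (hc 0%N); first exact: closed_closure.
    by move=> n _; apply: subset_closure; have [] := ga n.+1.
  - move=> [t /= t0 ft].
    have [n tn] : exists n : nat, t < n%:R.
      by have [N _ hN] := nbhs_infty_gtr t; exists N; apply: hN => /=.
    have [_ /(_ (ga n))[_ _ h _]] := ha n.
    by apply: (h _ (cB n.+1) t) => //; rewrite t0 an ltW.
  - have [_ /(_ (ga 0%N))[_ h _ _]] := ha 0%N.
    by move: (h _ (cB 1%N)); rewrite a0.
have [_ _ _ [Kc _] _] := hK _ Zc.
have dis z0 : E z0 -> K c `&` K z0 = set0.
  move=> Ez0; have [_ /(_ (ga (j (K z0))))[_ _ _ h]] := ha (j (K z0)).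
  by apply: h => //; exact: cB.
have nEc : ~ E c.
  by move=> Ec; have : (K c `&` K c) c by []; rewrite dis.
apply: (maxE (E `|` [set c])).
- split; first by move=> z Ez; left.
  by move=> h; apply: nEc; apply: h; right.
- by move=> z [/EZ //|->].
- move=> z z' [Ez|->] [Ez'|->] //; first exact: tE.
  + by rewrite setIC dis // => -[].
  + by rewrite dis // => -[].
Qed.

End Separation.

(** * Rays *)

Section Ray.
Context {R : realType}.

(** Composing with the absolute value makes the parametrization continuous on the line. *)
Lemma ray_param (T : topologicalType) (X : set T) : is_ray R X ->
  exists f : R -> T, [/\ continuous f,
    forall s t : R, 0 <= s -> 0 <= t -> f s = f t -> s = t &
    X = f @` [set t : R | 0 <= t]].
Proof.
move=> [f [cf [fX finj fsurj]]].
have I0 t : 0 <= t -> [set` `[0 : R, +oo[] t by rewrite /= in_itv /= andbT.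
have abs t : 0 <= t -> `|t| = t by exact: ger0_norm.
exists (fun t => f `|t|); split.
- move=> t; have /subspace_continuousP := cf; move=> /(_ `|t| (I0 _ (normr_ge0 t))) cft.
  move=> B /cft; rewrite /= /nbhs /= /within /= => h.
  have : \forall s \near t, [set` `[0 : R, +oo[] `|s| -> B (f `|s|).
    exact: (@norm_continuous _ R t _ h).
  by apply: filterS => s; apply; exact: I0.
- move=> s t s0 t0; rewrite !abs // => e.
  by apply: finj; rewrite ?inE //; exact: I0.
- apply/seteqP; split => [x /fsurj[t]|_ [t /= t0 <-]].
    by rewrite /= in_itv /= andbT => t0 <-; exists t; rewrite //= abs.
  by rewrite abs //; apply: fX; exact: I0.
Qed.

(** A continuous injection of a segment is a homeomorphism onto its image, because images
    of compact sets are closed. *)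
Lemma arc_path (f : R -> R * R) b : continuous f -> 0 < b ->
  (forall s t : R, 0 <= s -> 0 <= t -> f s = f t -> s = t) ->
  is_arc R (f @` [set t | 0 <= t <= b]).
Proof.
move=> cf b0 inj.
have [h hf] : exists h : R * R -> R, forall t, 0 <= t -> h (f t) = t.
  have /choice[h hh] : forall y, exists t, forall s, 0 <= s -> f s = y -> s = t.
    move=> y; have [[t [t0 ft]]|n] := pselect (exists t, 0 <= t /\ f t = y).
      by exists t => s s0 fs; apply: inj => //; rewrite ft.
    by exists 0 => s s0 fs; exfalso; apply: n; exists s.
  by exists h => t t0; apply/esym; exact: hh.
pose F t := f (b * t); pose G y := h y / b.
have cF : continuous F.
  by move=> t; apply: continuous_comp; [exact: mulrl_continuous|exact: cf].
have I01 t : [set` `[0 : R, 1]] t <-> 0 <= t <= 1 by rewrite /= in_itv.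
have scal t : 0 <= t <= 1 -> 0 <= b * t <= b.
  by move=> /andP[t0 t1]; rewrite mulr_ge0 ?(ltW b0) //= ler_piMr // ltW.
have GF t : 0 <= t -> G (F t) = t.
  by move=> t0; rewrite /G hf ?mulr_ge0 ?(ltW b0) // mulrC mulKf // gt_eqF.
exists F, G; split.
- split.
  + by move=> t /I01 /scal tb; exists (b * t).
  + move=> s t; rewrite !inE => /I01/andP[s0 _] /I01/andP[t0 _] e.
    by rewrite -(GF s) // e GF.
  + move=> _ [t /= /andP[t0 tb] <-]; exists (t / b).
      by apply/I01; rewrite divr_ge0 ?(ltW b0) //= ler_pdivrMr // mul1r.
    by rewrite /F mulrC divfK // gt_eqF.
- by move=> t; rewrite inE => /I01/andP[t0 _]; exact: GF.
- exact: continuous_subspaceT.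
- apply/subspace_continuousP => _ [t0 /= t0b <-] B hB.
  have Gt0 : G (f t0) = t0 / b by rewrite /G hf //; case/andP: t0b.
  have : nbhs (t0 / b) B by rewrite -Gt0.
  rewrite nbhsE => -[V [oV Vt0] VB].
  have cl : closed (F @` ([set` `[0 : R, 1]] `&` ~` V)).
    apply: compact_closed; first exact: norm_hausdorff.
    apply: continuous_compact; first exact: continuous_subspaceT.
    by apply: compact_closedI; [exact: segment_compact|exact: open_closedC].
  have : nbhs (f t0) (~` (F @` ([set` `[0 : R, 1]] `&` ~` V))).
    apply: open_nbhs_nbhs; split; first exact: closed_openC.
    move=> [s [/I01/andP[s0 _] nVs] e]; apply: nVs.
    by rewrite -(GF s) // e Gt0.
  rewrite /= /nbhs /= /within /=; apply: filterS => y ny [s /= /andP[s0 sb] fs].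
  apply: VB; apply: contrapT => nV; apply: ny; exists (s / b).
    split; last by have <- : G y = s / b by rewrite -fs /G hf.
    by apply/I01; rewrite divr_ge0 ?(ltW b0) //= ler_pdivrMr // mul1r.
  by rewrite /F mulrC divfK // gt_eqF.
Qed.

(** Otherwise the trace of the ray on the square would be contained in an arc
    [f ([0, b])]. *)
Lemma self_entwined_recurrent (f : R -> R * R) : continuous f ->
  (forall s t : R, 0 <= s -> 0 <= t -> f s = f t -> s = t) ->
  self_entwined R (f @` [set t : R | 0 <= t]) ->
  forall (y : R * R) e T, (f @` [set t : R | 0 <= t]) y -> 0 < e ->
  exists2 t, T < t /\ 0 <= t & ball y e (f t).
Proof.
move=> cf inj ent y e T Xy e0; apply: contrapT => no; apply: ent.
exists (ball y e); split; first exact: ball_open.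
  by exists y; split => //; exact: ballxx.
pose b := Num.max T 1.
have b0 : 0 < b by rewrite lt_max ltr01 orbT.
exists (f @` [set t | 0 <= t <= b]); split.
- exact: arc_path.
- by move=> _ [t /= /andP[t0 _] <-]; exists t.
- move=> x [yx [t /= t0 ft]]; exists t => //=; rewrite t0 /= leNgt; apply/negP => bt.
  apply: no; exists t; last by rewrite ft.
  by split => //; apply: le_lt_trans bt; rewrite le_max lexx.
Qed.

Lemma separating_radius (I : finType) (x : I -> R * R) : injective x ->
  exists2 r, 0 < r & forall i j z, i != j -> ball (x i) r z -> ~ ball (x j) r z.
Proof.
move=> xinj.
pose d (p : I * I) := `|x p.1 - x p.2| / 2.
exists (\big[Num.min/1]_(p : I * I | p.1 != p.2) d p).
  apply: lt_bigmin => [|[i j] /= ij]; first exact: ltr01.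
  by rewrite /d /= divr_gt0 // normr_gt0 subr_eq0; apply: contraNneq ij => /xinj ->.
move=> i j z ij; set r := \big[_/_]_(_ | _) _ => iz jz.
have rd : r <= d (i, j) by exact: bigmin_le_cond.
have : ball (x i) (r + r) (x j) by apply: ball_triangle iz _; exact: ball_sym.
rewrite -ball_normE /ball_ /= => h.
by move: rd; rewrite /d /= ler_pdivlMr // => rd; lra.
Qed.

(** If no square centered at [f 1], [f 2] or [f 3] gives an uncountable family, each of them
    contains a square without separation.  The stretches of the ray are taken one after
    the other, each starting near [f 0], outside the three squares, and lasting until
    it has visited the three subsquares. *)
Lemma self_entwined_non_suslinian (f : R -> R * R) : continuous f ->
  (forall s t : R, 0 <= s -> 0 <= t -> f s = f t -> s = t) ->
  (forall (y : R * R) e T, (f @` [set t : R | 0 <= t]) y -> 0 < e ->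
    exists2 t, T < t /\ 0 <= t & ball y e (f t)) ->
  non_suslinian (closure (f @` [set t : R | 0 <= t])).
Proof.
move=> cf inj recur; apply: contrapT => suslin; set X := f @` _ in recur suslin.
pose x (i : 'I_4) := f i%:R.
have xinj : injective x.
  by move=> i j /(inj _ _ (ler0n _ _) (ler0n _ _)) /eqP; rewrite eqr_nat => /eqP/val_inj.
have [r r0 disj] := separating_radius xinj.
pose cen (j : 'I_3) := x (lift ord0 j).
have disj3 (j k : 'I_3) z : j != k -> ball (cen j) r z -> ~ ball (cen k) r z.
  by move=> jk; apply: disj; rewrite (inj_eq lift_inj).
have far (j : 'I_3) z : ball (f 0) r z -> ~ ball (cen j) r z.
  by apply: (disj ord0); rewrite neq_lift.
have X0 : X (f 0) by exists 0 => //=.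
have Xcen k : X (cen k) by exists (lift ord0 k)%:R => //=; exact: ler0n.
have /choice[U hU] : forall j : 'I_3, exists U : (R * R) * R,
    [/\ X U.1, 0 < U.2, ball U.1 U.2 `<=` ball (cen j) r &
    forall u v p q, pass f (cen j) r u v -> X p -> X q -> ball U.1 U.2 p -> ball U.1 U.2 q ->
      off f u v p -> off f u v q -> side f (cen j) u v p = side f (cen j) u v q].
  move=> j; apply: contrapT => none; apply: suslin.
  apply: (@non_suslinian_mixed _ f cf inj (cen j) r r0 recur) => //; last exact: Xcen.
    move=> T; have [t [Tt _] ft] := recur _ _ T X0 r0.
    by exists t; [exact: ltW|exact: far].
  move=> y e Xy e0 yD; apply: contrapT => nsep; apply: none; exists (y, e); split => //=.
  move=> u v p q uvp Xp Xq yp yq op oq; apply: contrapT => pq.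
  by apply: nsep; exists u, v, p, q.
have /choice[ex hex] : forall T, exists t, [/\ T < t, 0 <= t & forall j, ~ ball (cen j) r (f t)].
  move=> T; have [t [Tt t0] ft] := recur _ _ T X0 r0; exists t; split => // k; exact: far.
have /choice[hit hhit] : forall a : 'I_3 * R, exists t,
    [/\ a.2 < t, 0 <= t & ball (U a.1).1 (U a.1).2 (f t)].
  move=> [j T]; have [XU U0 _ _] := hU j.
  by have [t [Tt t0] ft] := recur _ _ T XU U0; exists t.
pose fin T := \big[Num.max/0]_(j < 3) hit (j, ex T).
have hit_fin T j : hit (j, ex T) <= fin T by exact: le_bigmax.
have lt_fin T : T < fin T.
  have [Tex _ _] := hex T; have [exh _ _] := hhit (ord0, ex T).
  exact: lt_le_trans (lt_trans Tex exh) (hit_fin T ord0).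
(* The [i]-th stretch starts after [T i] and ends before [T i.+1]. *)
pose T i := iter i fin 0.
have Tle i k : (i <= k)%N -> T i <= T k.
  move=> /subnK <-; elim: (k - i)%N => [|m IH] //; rewrite addSn.
  exact: le_trans IH (ltW (lt_fin _)).
pose s (i : 'I_3) := ex (T i).
pose tau (j i : 'I_3) := hit (j, s i).
pose p (j : 'I_3) := f (hit (j, T 3%N)).
have s0 i : 0 <= s i by have [] := hex (T i).
have s_tau j i : s i < tau j i by have [] := hhit (j, s i).
have tau_T j (i : 'I_3) k : (i < k)%N -> tau j i <= T k.
  by move=> ik; apply: le_trans (Tle _ _ ik); exact: hit_fin.
have T_s (i : 'I_3) : T i < s i by have [] := hex (T i).
have UD j t : ball (U j).1 (U j).2 (f t) -> ball (cen j) r (f t).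
  by have [_ _ h _] := hU j; exact: h.
apply: (@k33_not_planar _ f cf cen (fun=> r) (fun=> r0) p s tau) => //.
- by move=> j; apply: UD; have [] := hhit (j, T 3%N).
- by move=> j i; apply: UD; have [] := hhit (j, s i).
- by move=> j i; have [_ _] := hex (T i).
- by move=> j i; exact: ltW.
- move=> j k i; apply: off_inj => //; apply: (@le_lt_trans _ _ (T 3%N)).
    exact: tau_T.
  by have [] := hhit (j, T 3%N).
- move=> i l j k y il /andP[sy yt].
  have y0 : 0 <= y by exact: le_trans (s0 i) sy.
  move: il; rewrite neq_ltn => /orP[il|li].
    move=> t /andP[st tt] e.
    have ty : t = y by apply: inj => //; exact: le_trans (s0 l) st.
    have := le_lt_trans (le_trans yt (tau_T j i l il)) (T_s l).
    by rewrite ltNge -ty st.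
  apply: off_inj => //; apply: lt_le_trans sy.
  exact: le_lt_trans (tau_T k l i li) (T_s i).
- move=> j i u v uvp op oq; have [_ _ _ h] := hU j; apply: h => //.
  + by exists (hit (j, T 3%N)) => //=; have [] := hhit (j, T 3%N).
  + by exists (tau j i) => //=; have [] := hhit (j, s i).
  + by have [] := hhit (j, T 3%N).
  + by have [] := hhit (j, s i).
Qed.

End Ray.

Theorem theorem1 (R : realType) (X : set (R * R)%type)
  (rayX : is_ray R X) (entX : self_entwined R X) :
  non_suslinian (closure X).
Proof.
have [f [cf inj XE]] := ray_param rayX; subst X.
by apply: self_entwined_non_suslinian => //; exact: self_entwined_recurrent.
Qed.
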